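(* Let $(W^0,W^1)$ be a standard two-dimensional Brownian motion over $\mathbb{R}_+$, let $a,b,c>0$, $\alpha\in(0,\tfrac12)$, $\rho\in[-1,1]$, and set $W^\alpha:=D^\alpha(W^1)$ and $W^\rho:=\sqrt{1-\rho^2}\,W^0+\rho W^1$. For $n\in\mathbb{N}$ let $X^n$ and $S^n$ be the unique processes over $\mathbb{R}_+$ with $X^n_0=0$ and $$(X^n_t)'=n\left(aW^\alpha_{X^n_t}+bt-X^n_t\right)+c,\qquad S^n_t=\exp\left(W^\rho_{X^n_t}-\tfrac12X^n_t\right).$$ Let $X^0_t:=\inf\{x>0:x-aW^\alpha_x>bt\}$ and define the interval-valued (fractional NIG excursion) process $$S^\bullet_t:=\left\{\exp\left(W^\rho_x-\tfrac12x\right):x\in[X^0_{t_-},X^0_t]\right\}.$$ Then, identifying $S^n$ with the singleton-valued process $t\mapsto\{S^n_t\}$, almost surely $d_{\mathrm{E}}(S^n,S^\bullet)\to0$ as $n\to\infty$.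
   Context: $\mathbb{R}_+=[0,\infty)$. For a path $w$ with $w(0)=0$ that is locally Hölder continuous of order $\lambda\in(0,1)$ on $\mathbb{R}_+$ and $\alpha\in(0,\lambda)$, the Riemann-Liouville fractional derivative is $D^\alpha(w)(x):=\frac{1}{\Gamma(1-\alpha)}\frac{\mathrm{d}}{\mathrm{d}x}\int_0^x\frac{w(u)}{(x-u)^\alpha}\,\mathrm{d}u$, a well-defined locally $(\lambda-\alpha)$-Hölder path starting from $0$; it is applied pathwise to $W^1$. $W^\alpha$ and $W^\rho$ denote different processes. $X^0_{t_-}:=\lim_{s\uparrow t}X^0_s$ for $t>0$ and $X^0_{0_-}:=0$. $X^0$ a.s. has strictly increasing, unbounded, finite càdlàg paths. $\mathrm{E}$ is the set of maps $\varepsilon$ assigning to each $t\in\mathbb{R}_+$ a nonempty compact interval $\varepsilon(t)\subset\mathbb{R}$ (possibly a singleton). For $T\in\mathbb{R}_+$ set $\Gamma_T(\varepsilon):=\{(t,x)\in[0,T]\times\mathbb{R}:x\in\varepsilon(t)\}$ and $\Gamma^*_T(\varepsilon):=\Gamma_T(\varepsilon)\cup(\{T\}\times\mathbb{R})$. Let $d_{\mathrm{E},T}(\varepsilon_1,\varepsilon_2)$ be the Hausdorff distance (w.r.t. the Euclidean norm) between $\Gamma_1:=\Gamma^*_T(\varepsilon_1)$ and $\Gamma_2:=\Gamma^*_T(\varepsilon_2)$, i.e. $\max\{\sup_{a\in\Gamma_1}\inf_{b\in\Gamma_2}|a-b|,\ \sup_{a\in\Gamma_2}\inf_{b\in\Gamma_1}|a-b|\}$.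 Then $d_{\mathrm{E}}(\varepsilon_1,\varepsilon_2):=\sum_{n\in\mathbb{N}}2^{-n}(1\wedge d_{\mathrm{E},n}(\varepsilon_1,\varepsilon_2))$ (a pseudometric). *)

(* Defs.v *)
From HB Require Import structures.
From mathcomp Require Import all_boot all_order all_algebra.
From mathcomp Require Import all_classical all_reals all_analysis.

Set Implicit Arguments.
Unset Strict Implicit.
Unset Printing Implicit Defensive.

Import Order.TTheory GRing.Theory Num.Theory.
Import numFieldNormedType.Exports.

Local Open Scope classical_set_scope.
Local Open Scope ring_scope.

(* Paths and processes over R_+ = [0, +oo[ are functions on R; their values at
   negative arguments are never constrained and never matter. *)

Section BrownianMotion.
Context {d : measure_display} {T : measurableType d} {R : realType}.
Variable P : probability T R.

Definition process_sigma (I : set R) (W : R -> {RV P >-> R}) : set (set T) :=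
  <<s \bigcup_(t in I) g_sigma_algebra_preimage (W t) >>.

Definition independent_systems (F G : set (set T)) : Prop :=
  forall A B, F A -> G B -> P (A `&` B) = (P A * P B)%E.

(* The second parameter of normal_prob is the standard deviation. *)
Record standard_BM (W : R -> {RV P >-> R}) : Prop := StandardBM {
  BM_start : {ae P, forall w, W 0 w = 0};
  BM_independent_increments : forall s t, 0 <= s -> s < t ->
    independent_systems (process_sigma `[0, s] W)
      (g_sigma_algebra_preimage (fun w => W t w - W s w));
  BM_gaussian_increments : forall s t, 0 <= s -> s < t ->
    forall B, measurable B ->
      P ((fun w => W t w - W s w) @^-1` B)
      = normal_prob 0 (Num.sqrt (t - s)) B;
  BM_continuous_paths :
    {ae P, forall w, {within `[0, +oo[, continuous (fun t => W t w)}} }.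

Definition standard_BM2 (W0 W1 : R -> {RV P >-> R}) : Prop :=
  [/\ standard_BM W0, standard_BM W1 &
      independent_systems (process_sigma `[0, +oo[ W0)
                          (process_sigma `[0, +oo[ W1)].

End BrownianMotion.

Section Paths.
Context {R : realType}.
Implicit Types (w x : R -> R) (t : R).

Definition Gamma (z : R) : R :=
  \int[lebesgue_measure]_(u in `]0, +oo[) (u `^ (z - 1) * expR (- u)).

(* The integral vanishes for y <= 0, so for the paths w considered (w 0 = 0,
   locally Hoelder of order > alpha) the two-sided derivative at z = 0 exists
   and equals the one-sided derivative 0. At u = y the integrand is 0 by the
   convention 0^-1 = 0, on a null set. *)
Definition riemann_liouville (alpha : R) w : R -> R := fun z =>
  (Gamma (1 - alpha))^-1 *
  derive1 (fun y => \int[lebesgue_measure]_(u in `[0, y]) (w u / (y - u) `^ alpha)) z.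

(* Derivative at t >= 0 of a path over R_+: one-sided at t = 0. *)
Definition has_derivative_Rplus x t (l : R) : Prop :=
  h^-1 * (x (t + h) - x t) @[h --> within [set h | 0 <= t + h] 0^'] --> l.

(* wa plays the role of a path of W^alpha; x must be R_+-valued since wa is
   only defined over R_+. *)
Definition excursion_ode (a b c : R) (n : nat) wa x : Prop :=
  x 0 = 0 /\
  forall t, 0 <= t -> 0 <= x t /\
    has_derivative_Rplus x t (n%:R * (a * wa (x t) + b * t - x t) + c).

Definition first_passage (a b : R) wa : R -> R := fun t =>
  inf [set x : R | 0 < x /\ b * t < x - a * wa x].

Definition left_limit x : R -> R := fun t =>
  if 0 < t then lim (x s @[s --> t^'-]) else 0.

End Paths.

(* Maps e : R -> set R stand for set-valued maps over R_+. *)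
Section ExcursionMetric.
Context {R : realType}.
Implicit Types (e : R -> set R) (G : set (R * R)).

Definition interval_valued e : Prop :=
  forall t, 0 <= t -> exists l u : R, l <= u /\ e t = `[l, u]%classic.

Definition graph_upto (t0 : R) e : set (R * R) :=
  [set p | 0 <= p.1 <= t0 /\ e p.1 p.2].

Definition graph_upto_star (t0 : R) e : set (R * R) :=
  graph_upto t0 e `|` [set p | p.1 = t0].

(* The library's norm on R * R is the maximum norm. *)
Definition euclidean_dist (p q : R * R) : R :=
  Num.sqrt ((p.1 - q.1) ^+ 2 + (p.2 - q.2) ^+ 2).

Local Open Scope ereal_scope.

Definition excess G1 G2 : \bar R :=
  ereal_sup [set ereal_inf [set (euclidean_dist p q)%:E | q in G2] | p in G1].

Definition hausdorff_dist G1 G2 : \bar R :=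
  Order.max (excess G1 G2) (excess G2 G1).

Definition dE_upto (t0 : R) e1 e2 : \bar R :=
  hausdorff_dist (graph_upto_star t0 e1) (graph_upto_star t0 e2).

Definition dE e1 e2 : \bar R :=
  \sum_(1 <= n <oo) ((2 ^- n)%R%:E * Order.min 1 (dE_upto n%:R e1 e2)).

End ExcursionMetric.

(* Main.v *)
Require Import Defs.
From HB Require Import structures.
From mathcomp Require Import all_boot all_order all_algebra.
From mathcomp Require Import all_classical all_reals all_analysis.
From mathcomp Require Import measurable_realfun.
From mathcomp Require Import ring lra.

Import Order.TTheory GRing.Theory Num.Theory.
Import numFieldNormedType.Exports.

Local Open Scope classical_set_scope.
Local Open Scope ring_scope.

(** Put [f x = x - a * W^alpha_x].  Pathwise, [x] belongs to the excursion
    interval at time [s] if and only if the running maximum of [f] at [x] equals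
    [b * s].  The solution [X^n] is nondecreasing, and the running maximum of [f]
    at [X^n_t] is within [b * dl] of [b * t] once [n] is large.  Hence each of the
    two graphs has, at every one of its points, a point of the other graph with the
    same value (the image of the same [x]) and a time differing by at most [dl].
    This needs [f] to be continuous, null at 0 and unbounded above.  By
    Borel-Cantelli over the scales [2^k], Brownian motion has on [[0, 2^k]] a
    lambda-Hoelder constant O(2^(k(1 - lambda))) for every [lambda < 1/2]; and for
    [alpha < lambda] a fractional derivative is, up to a constant, the Weyl form
    [M^-alpha w(y) + alpha * int_0^M r^(-1-alpha) (w(y) - w(y - r)) dr], which is
    therefore continuous and O(2^(k(1 - alpha))) on [[0, 2^k]]. *)

(** * First passages and excursion intervals *)

(** Points are matched by moving them in time only, so no modulus of continuity of S enters; a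
    partner time beyond the horizon is replaced by a point of the vertical line in
    [graph_upto_star]. The drift n(b t - f(X)) makes X^n sweep, within time [dl], any stretch on
    which f stays below b s, while monotonicity keeps f(X) from exceeding b t by more than c/n. For
    the fractional derivative the obstacle is that (y - u)^-alpha cannot be differentiated in y
    under the integral. Cutting the kernel into layers and exchanging the integrations moves y into
    increments of a primitive of w. Their derivatives are increments of w, of size r^lambda, and
    lambda > alpha makes domination against r^(-1-alpha) possible. With M = 2^k both terms of the
    Weyl form have order 2^(k(1 - lambda)) 2^(k(lambda - alpha)), which is o(2^k): this is what
    makes f unbounded. *)

Section Passage.
Context {R : realType}.
Variables (f : R -> R) (b : R).
Hypotheses (b_gt0 : 0 < b) (f_cont : continuous f) (f0 : f 0 = 0).
Hypothesis f_unbounded : forall A, exists2 y, 0 < y & A < f y.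

Let above t := [set x : R | 0 < x /\ b * t < f x].

Definition passage t : R := inf (above t).

Lemma passage_ge t y :
  (forall z, 0 <= z <= y -> f z <= b * t) -> y <= passage t.
Proof.
move=> fy; apply: lb_le_inf.
  by have [z z0 fz] := f_unbounded (b * t); exists z.
move=> z [z0 fz]; rewrite leNgt; apply/negP => zy.
by have := fy z; rewrite (ltW z0) (ltW zy) => /(_ isT); rewrite leNgt fz.
Qed.

Lemma passage_le t z : 0 < z -> b * t < f z -> passage t <= z.
Proof.
move=> z0 fz; apply: ge_inf; last by split.
by exists 0 => x [/ltW].
Qed.

Lemma passage_ge0 t : 0 <= passage t.
Proof.
apply: lb_le_inf; last by move=> x [/ltW].
by have [z z0 fz] := f_unbounded (b * t); exists z.
Qed.

Lemma passage_mono r s : r <= s -> passage r <= passage s.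
Proof.
move=> rs; apply: lb_le_inf.
  by have [z z0 fz] := f_unbounded (b * s); exists z.
by move=> x [x0 fx]; apply: passage_le => //; rewrite (le_lt_trans _ fx)// ler_pM2l.
Qed.

(** The end point [z = passage t] is included: by continuity a level exceeded at [z] is already
    exceeded a little to its left. *)
Lemma passage_below t z : 0 <= t -> 0 <= z <= passage t -> f z <= b * t.
Proof.
move=> t0 /andP[]; rewrite le_eqVlt => /predU1P[<- _|z0 zp].
  by rewrite f0 mulr_ge0// ltW.
rewrite leNgt; apply/negP => fz.
have : \forall y \near z, 0 < y /\ b * t < f y.
  near=> y; split; near: y.
    exact: lt_nbhsr.
  by apply: (@cvgr_gt _ _ _ _ f (f z)) => //; exact: f_cont.
move=> /nbhs_ballP[e /= e0 ze].
have := ze (z - e / 2).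
rewrite /ball/= opprB addrC subrK ger0_norm ?ltr_pdivrMr//; last by rewrite divr_ge0// ltW.
rewrite ltr_pMr// ltr1n => /(_ isT)[y0 fy].
have := passage_le _ _ y0 fy => /(le_trans zp).
by rewrite lerBrDl gerDr leNgt divr_gt0.
Unshelve. all: by end_near. Qed.

(** Strictness at [y] persists on a neighbourhood, so the level is not exceeded before
    [y + e / 2]. *)
Lemma passage_gt t y :
  0 <= y -> (forall z, 0 <= z <= y -> f z < b * t) -> y < passage t.
Proof.
move=> y0 fy.
have : \forall z \near y, f z < b * t.
  by apply: (cvgr_lt (f y) (f_cont y)); rewrite fy ?y0 ?lexx.
move=> /nbhs_ballP[e /= e0 ye].
apply: (@lt_le_trans _ _ (y + e / 2)).
  by rewrite ltrDl divr_gt0.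
apply: passage_ge => z /andP[z0 ze].
have [zy|yz] := leP z y; first by rewrite ltW// fy// z0.
apply/ltW/ye; rewrite /ball/= ltr_distlC; apply/andP; split; last lra.
by rewrite ltrBlDr ltr_wpDr// ltW.
Qed.

(** By monotonicity the left limit is the supremum of the earlier values; [lim] being total, its
    existence has to be proved first. *)
Lemma left_limit_passage_le s y : 0 < s ->
  (left_limit passage s <= y) <-> (forall r, 0 <= r < s -> passage r <= y).
Proof.
move=> s0; rewrite /left_limit s0.
have cvgp : cvg (passage x @[x --> s^'-]).
  apply: nondecreasing_at_left_is_cvgr.
    by apply: nearW => x u v _ _ /passage_mono.
  apply: nearW => x; exists (passage s) => _ [u /= + <-].
  by rewrite in_itv/= => /andP[_ /ltW/passage_mono].
split => [ly r /andP[r0 rs]|ry].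
  apply: le_trans ly; apply: limr_ge => //.
  near=> x; apply: passage_mono; near: x.
  exact: nbhs_left_ge.
apply: limr_le => //; near=> x; apply: ry; apply/andP; split; near: x.
  exact: nbhs_left_ge.
exact: nbhs_left_lt.
Unshelve. all: by end_near. Qed.

Lemma left_limit_passage_ge0 s : 0 <= left_limit passage s.
Proof.
rewrite /left_limit; case: ifPn => // s0; apply: limr_ge; last first.
  by apply: nearW => x; exact: passage_ge0.
apply: nondecreasing_at_left_is_cvgr.
  by apply: nearW => x u v _ _ /passage_mono.
apply: nearW => x; exists (passage s) => _ [u /= + <-].
by rewrite in_itv/= => /andP[_ /ltW/passage_mono].
Qed.

Lemma left_limit_passage_le_passage s : 0 <= s ->
  left_limit passage s <= passage s.
Proof.
rewrite le_eqVlt => /predU1P[<-|s0].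
  by rewrite /left_limit ltxx passage_ge0.
by apply/left_limit_passage_le => // r /andP[_ /ltW/passage_mono].
Qed.

(** The right end of the interval bounds the running maximum of [f] at [y] from above by [b * s],
    the left end from below. *)
Lemma excursion_intervalP s y : 0 <= s -> 0 <= y ->
  left_limit passage s <= y <= passage s <->
  (forall z, 0 <= z <= y -> f z <= b * s) /\
  (exists2 z, 0 <= z <= y & b * s <= f z).
Proof.
move=> s0 y0; split=> [/andP[ly yu]|[fle [z zy fz]]].
  split=> [z /andP[z0 zy]|].
    by apply: passage_below => //; rewrite z0 (le_trans zy).
  have [c + cmax] := EVT_max y0 (continuous_subspaceT f_cont).
  rewrite in_itv/= => cy; exists c => //.
  rewrite leNgt; apply/negP => fc.
  (* [f 0 = 0] makes the maximum nonnegative, so [s] is not 0 and [left_limit] is a genuine limit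
     there. *)
  have s1 : 0 < s.
    rewrite -(pmulr_rgt0 _ b_gt0) (le_lt_trans _ fc)// -f0 cmax//.
    by rewrite in_itv/= lexx.
  (* For [r] strictly between, [f] stays below [b * r] up to [y], so [passage r] lies beyond [y]
     although it is at most the left limit. *)
  have [r /andP[fr rs]] : exists r, f c < b * r < b * s.
    exists ((f c / b + s) / 2).
    have -> : b * ((f c / b + s) / 2) = (f c + b * s) / 2.
      by field; rewrite gt_eqF.
    by lra.
  have r0 : 0 <= r.
    rewrite -(pmulr_rge0 _ b_gt0) (le_trans _ (ltW fr))// -f0 cmax//.
    by rewrite in_itv/= lexx.
  have : y < passage r.
    apply: passage_gt => // z zy; rewrite (le_lt_trans _ fr)// cmax//.
  rewrite ltNge => /negP; apply.
  by move/(left_limit_passage_le _ _ s1) : ly; apply; rewrite r0; move: rs; rewrite ltr_pM2l.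
rewrite passage_ge// andbT.
move: s0; rewrite le_eqVlt => /predU1P[<-|s0].
  by rewrite /left_limit ltxx.
apply/left_limit_passage_le => // r /andP[r0 rs].
have frz : b * r < f z by rewrite (lt_le_trans _ fz)// ltr_pM2l.
move: zy => /andP[z0 zy]; apply: le_trans zy; apply: passage_le => //.
rewrite lt_neqAle z0 andbT; apply/eqP => z00.
by move: frz; rewrite -z00 f0 ltNge mulr_ge0// ltW.
Qed.

(** The time is the running maximum of [f] at [y], divided by [b]. *)
Lemma excursion_interval_cover y : 0 <= y ->
  exists2 s, 0 <= s & left_limit passage s <= y <= passage s.
Proof.
move=> y0; have [c + cmax] := EVT_max y0 (continuous_subspaceT f_cont).
rewrite in_itv/= => cy.
have fc0 : 0 <= f c by rewrite -f0 cmax// in_itv/= lexx.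
exists (f c / b); first by rewrite divr_ge0// ltW.
apply/excursion_intervalP => //; first by rewrite divr_ge0// ltW.
have -> : b * (f c / b) = f c by rewrite mulrC divfK// gt_eqF.
by split=> [z zy|]; [exact: cmax | exists c].
Qed.

End Passage.
(** * The excursion equation *)

(** The hits form a compact set with a least element; a value at or above [y] before it would force
    an earlier hit. *)
Lemma first_hit {R : realType} (g : R -> R) (t0 t1 y : R) :
  continuous g -> t0 <= t1 -> g t0 < y < g t1 ->
  exists u, [/\ t0 < u <= t1, g u = y & forall v, t0 <= v < u -> g v < y].
Proof.
move=> gc t01 /andP[gt0 gt1].
have gw (u v : R) : {within `[u, v], continuous g} by exact: continuous_subspaceT.
pose A := `[t0, t1] `&` g @^-1` [set y].
have A0 : A !=set0.
  have [|c ct cy] := @IVT _ g t0 t1 y t01 (gw _ _); last by exists c.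
  by rewrite ge_min le_max (ltW gt0) (ltW gt1) orbT.
have cA : compact A.
  apply: compact_closedI; first exact: segment_compact.
  by apply: closed_comp => [u _|]; [exact: gc | exact: closed_eq].
have idc : continuous (fun z : R => z) by move=> z; exact: cvg_id.
have [u + umin] := compact_EVT_min A0 cA (continuous_subspaceT idc).
rewrite inE => -[]; rewrite /= in_itv/= => /andP[t0u ut1] gu.
exists u; split=> //.
  by rewrite ut1 andbT lt_neqAle t0u andbT; apply: contraTneq gt0 => ->; rewrite gu ltxx.
move=> v /andP[t0v vu]; rewrite ltNge; apply/negP => yv.
have [|c] := @IVT _ g t0 v y t0v (gw _ _).
  by rewrite ge_min le_max (ltW gt0) yv orbT.
rewrite in_itv/= => /andP[t0c cv] gc_y.
have : u <= c.
  apply: umin; rewrite inE; split=> //=.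
  by rewrite in_itv/= t0c (le_trans cv)// (le_trans (ltW vu)).
by rewrite leNgt (le_lt_trans cv vu).
Qed.

Section HalfLineDerivative.
Context {R : realType}.
Implicit Types (x : R -> R) (t l : R).

Lemma has_derivative_RplusP x t l : has_derivative_Rplus x t l ->
  forall e, 0 < e -> exists2 k, 0 < k & forall h, h != 0 -> `|h| < k ->
    0 <= t + h -> `|l - h^-1 * (x (t + h) - x t)| < e.
Proof.
move=> /cvgrPdist_lt xl e e0; have := xl e e0.
rewrite near_withinE => /nbhs_ballP[k /= k0 kP].
by exists k => // h h0 hk th; apply: kP => //; rewrite /ball/= sub0r normrN.
Qed.

Lemma has_derivative_Rplus_right_ge0 x t l : 0 <= t ->
  has_derivative_Rplus x t l ->
  (forall s, t < s -> x t <= x s) -> 0 <= l.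
Proof.
move=> t0 /has_derivative_RplusP xl xts; rewrite leNgt; apply/negP => l0.
have [|k k0 kP] := xl (- l); first by rewrite oppr_gt0.
have h0 : 0 < k / 2 by rewrite divr_gt0.
have := kP (k / 2) (lt0r_neq0 h0).
rewrite gtr0_norm// ltr_pdivrMr// ltr_pMr// ltr1n => /(_ isT).
rewrite addr_ge0 ?(ltW h0)// => /(_ isT).
rewrite ltr_norml => /andP[lq _].
have q0 : 0 <= (k / 2)^-1 * (x (t + k / 2) - x t).
  by rewrite mulr_ge0 ?invr_ge0 ?(ltW h0)// subr_ge0 xts// ltrDl.
lra.
Qed.

Lemma has_derivative_Rplus_left_ge0 x r t l : 0 <= r < t ->
  has_derivative_Rplus x t l ->
  (forall s, r <= s < t -> x s <= x t) -> 0 <= l.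
Proof.
move=> /andP[r0 rt] /has_derivative_RplusP xl xts; rewrite leNgt; apply/negP => l0.
have [|k k0 kP] := xl (- l); first by rewrite oppr_gt0.
pose h := Num.min (k / 2) (t - r).
have h0 : 0 < h by rewrite lt_min subr_gt0 rt divr_gt0.
have hk : h < k by rewrite gt_min ltr_pdivrMr// ltr_pMr// ltr1n.
have ht : h <= t - r by rewrite ge_min lexx orbT.
have := kP (- h); rewrite oppr_eq0 gt_eqF// normrN gtr0_norm// subr_ge0.
have ht' : h <= t by lra.
move=> /(_ isT hk ht'); rewrite ltr_norml => /andP[lq _].
have q0 : 0 <= (- h)^-1 * (x (t - h) - x t).
  rewrite invrN mulNr -mulrN opprB mulr_ge0 ?invr_ge0 ?(ltW h0)// subr_ge0 xts//.
  by rewrite lerBrDl -lerBrDr ht gtrBl.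
lra.
Qed.

Lemma has_derivative_RplusN x t l :
  has_derivative_Rplus x t l -> has_derivative_Rplus (\- x) t (- l).
Proof.
move=> xl; rewrite /has_derivative_Rplus.
under eq_fun do rewrite /= -opprD mulrN.
exact: cvgN.
Qed.

(** Near a positive time the constraint [0 <= t + h] is void. *)
Lemma has_derivative_Rplus_is_derive x t l : 0 < t ->
  has_derivative_Rplus x t l -> is_derive t 1 x l.
Proof.
move=> t0 /has_derivative_RplusP xl.
have xtl : h^-1 *: (x (h *: 1 + t) - x t) @[h --> 0^'] --> l.
  apply/cvgrPdist_lt => e e0; have [k k0 kP] := xl e e0.
  rewrite near_withinE; apply/nbhs_ballP; exists (Num.min k t).
    by rewrite /= lt_min k0.
  move=> h; rewrite /ball/= sub0r normrN lt_min => /andP[hk ht] h0.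
  rewrite [h *: 1]mulr1 [h + t]addrC; apply: kP => //.
  by move: ht; rewrite ltr_norml => /andP[+ _]; lra.
apply: DeriveDef; first by apply/cvg_ex; exists l.
exact/cvg_lim.
Qed.

(** Freezing the path at its value at 0 for negative times turns continuity over R_+ into continuity
    on the line. *)
Lemma has_derivative_Rplus_continuous x :
  (forall t, 0 <= t -> exists l, has_derivative_Rplus x t l) ->
  continuous (fun t => x (Num.max t 0)).
Proof.
move=> xd t; have [t0|t0] := ltP t 0.
  apply/cvgrPdist_lt => e e0; near=> y.
  have y0 : y < 0 by near: y; exact: lt_nbhsl.
  by rewrite !max_r ?ltW// subrr normr0.
have [l /has_derivative_RplusP/(_ _ ltr01)[k k0 kP]] := xd t t0.
apply/cvgrPdist_lt => e e0.
have le0 : 0 < `|l| + 1 by rewrite ltr_wpDl.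
apply/nbhs_ballP; exists (Num.min k (e / (`|l| + 1))).
  by rewrite /= lt_min k0 divr_gt0.
move=> y; rewrite /ball/= lt_min => /andP[yk ye].
rewrite (max_l t0); set m := Num.max y 0.
have my : `|t - m| <= `|t - y|.
  rewrite /m; case: (ltP y 0) => [y0|//].
  by rewrite subr0 ger0_norm// ger0_norm; lra.
have [->|mt] := eqVneq m t; first by rewrite subrr normr0.
have := kP (m - t); rewrite subr_eq0 mt addrCA subrr addr0 distrC.
rewrite (le_lt_trans my yk) /m le_max lexx orbT -/m => /(_ isT isT isT) d1.
have {}d1 : `|(m - t)^-1 * (x m - x t)| < `|l| + 1.
  have := ler_normB l (l - (m - t)^-1 * (x m - x t)).
  rewrite opprB addrCA subrr addr0; lra.
rewrite distrC.
have -> : x m - x t = ((m - t)^-1 * (x m - x t)) * (m - t).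
  by rewrite mulrAC mulVf ?mul1r// subr_eq0.
rewrite normrM (distrC m t); apply: (@le_lt_trans _ _ ((`|l| + 1) * `|t - y|)).
  by apply: ler_pM => //; exact: ltW.
by rewrite mulrC -ltr_pdivlMr.
Unshelve. all: by end_near. Qed.

End HalfLineDerivative.
Section ExcursionOde.
Context {R : realType}.
Variables (f x : R -> R) (b c : R) (n : nat).
Hypotheses (b_gt0 : 0 < b) (c_ge0 : 0 <= c) (n_gt0 : (0 < n)%N) (x0 : x 0 = 0).
Hypothesis x_ge0 : forall t, 0 <= t -> 0 <= x t.
Hypothesis x_ode : forall t, 0 <= t ->
  has_derivative_Rplus x t (n%:R * (b * t - f (x t)) + c).

Let X t := x (Num.max t 0).

Let X_continuous : continuous X.
Proof. by apply: has_derivative_Rplus_continuous => t /x_ode; eexists; eauto. Qed.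

Let XE t : 0 <= t -> X t = x t.
Proof. by move=> t0; rewrite /X max_l. Qed.

Lemma ode_attains t y : 0 <= t -> 0 <= y <= x t ->
  exists2 u, 0 <= u <= t & x u = y.
Proof.
move=> t0 /andP[y0 yx].
have [|u ut Xu] := @IVT _ X 0 t y t0 (continuous_subspaceT X_continuous).
  by rewrite !XE// x0 ge_min le_max y0 yx orbT.
by move: ut; rewrite in_itv/= => ut; exists u; rewrite // -XE//; case/andP: ut.
Qed.

(* At its first visit to a level the solution has nonnegative speed, and at any
   later visit the speed is larger: so it never crosses a level downwards. *)
Lemma ode_nondecreasing s t : 0 <= s -> s <= t -> x s <= x t.
Proof.
move=> s0 st; rewrite leNgt; apply/negP => xts.
have t0 := le_trans s0 st.
pose y := (x s + x t) / 2.
have ys : y < x s by rewrite /y; lra.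
have ty : x t < y by rewrite /y; lra.
have y0 : 0 < y by rewrite (le_lt_trans _ ty)// x_ge0.
have [|u [/andP[u0 us] Xu uP]] := @first_hit _ X 0 s y X_continuous s0.
  by rewrite !XE// x0 y0.
have NXc : continuous (\- X) by move=> z; apply: cvgN; exact: X_continuous.
(* The first downward crossing of [y] by [X] is the first upward hit of [- y] by [\- X]. *)
have [|v [/andP[sv vt] Xv vP]] := @first_hit _ (\- X) s t (- y) NXc st.
  by rewrite /= !XE// !ltrN2 ys.
have v0 : 0 < v := le_lt_trans s0 sv.
have xu : x u = y by rewrite -XE// ltW.
have xv : x v = y by apply: oppr_inj; rewrite -[in LHS]XE ?ltW.
have du : 0 <= n%:R * (b * u - f y) + c.
  rewrite -xu; apply: (has_derivative_Rplus_left_ge0 _ 0 u) (x_ode _ (ltW u0)) _.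
    by rewrite lexx.
  by move=> r /andP[r0 ru]; rewrite xu -XE// ltW// uP// r0.
have dv : 0 <= - (n%:R * (b * v - f y) + c).
  rewrite -xv.
  apply: (has_derivative_Rplus_left_ge0 (\- x) s v _ _
    (has_derivative_RplusN _ _ _ (x_ode _ (ltW v0)))); first by rewrite s0.
  move=> r /andP[sr rv]; have := vP r; rewrite sr rv => /(_ isT) /=.
  by rewrite XE ?(le_trans s0)// xv => /ltW.
have : 0 < n%:R * (b * (v - u)).
  by rewrite mulr_gt0 ?ltr0n// mulr_gt0// subr_gt0 (le_lt_trans us).
lra.
Qed.

(** Each such [z] is a value [x u] with [u <= t], where the speed of a nondecreasing solution is
    nonnegative; dividing by [n] bounds [f z]. *)
Lemma ode_running_max_le t z : 0 <= t -> 0 <= z <= x t ->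
  f z <= b * t + c / n%:R.
Proof.
move=> t0 /(ode_attains _ _ t0)[u /andP[u0 ut] <-].
have : 0 <= n%:R * (b * u - f (x u)) + c.
  apply: has_derivative_Rplus_right_ge0 (x_ode _ u0) _ => //.
  by move=> s /ltW; exact: ode_nondecreasing.
rewrite -(pmulr_rge0 _ (_ : 0 < n%:R^-1 :> R)) ?invr_gt0 ?ltr0n//.
rewrite mulrDr mulKf ?pnatr_eq0 -?lt0n// (mulrC _ c).
have : b * u <= b * t by rewrite ler_pM2l.
lra.
Qed.

(** While the solution is below [y], [f] along it is at most [b * s]. So from time [s + dl / 2] on
    its speed is at least [n * b * dl / 2], and the remaining [dl / 2] suffices to climb from a
    nonnegative value to [y]. *)
Lemma ode_reaches s dl y : 0 <= s -> 0 < dl ->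
  (forall z, 0 <= z <= y -> f z <= b * s) ->
  y <= n%:R * (b * (dl / 2)) * (dl / 2) -> y <= x (s + dl).
Proof.
move=> s0 d0 fy yn; rewrite leNgt; apply/negP => xy.
have d20 : 0 < dl / 2 by rewrite divr_gt0.
have lt_ : s + dl / 2 < s + dl by lra.
have [|r rsd] := @MVT _ X (fun t => n%:R * (b * t - f (x t)) + c) _ _ lt_
    _ (continuous_subspaceT X_continuous).
  move=> r; rewrite in_itv/= => /andP[r1 r2].
  have r0 : 0 < r by lra.
  apply: (@near_eq_is_derive _ _ _ x) => //.
    by near=> w; rewrite XE// ltW//; near: w; exact: lt_nbhsr.
  exact: has_derivative_Rplus_is_derive r0 (x_ode _ (ltW r0)).
move: rsd; rewrite in_itv/= => /andP[r1 r2].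
have r0 : 0 < r by lra.
rewrite !XE; [|lra|lra].
have -> : s + dl - (s + dl / 2) = dl / 2 by rewrite opprD addrACA subrr add0r; lra.
have fr : f (x r) <= b * s.
  by apply: fy; rewrite x_ge0 ?(ltW r0)//= ltW// (le_lt_trans _ xy)// ode_nondecreasing// ltW.
have xd : 0 <= x (s + dl / 2) by apply: x_ge0; lra.
have : n%:R * (b * (dl / 2)) * (dl / 2) <=
       (n%:R * (b * r - f (x r)) + c) * (dl / 2).
  rewrite ler_pM2r//; apply: (@le_trans _ _ (n%:R * (b * r - f (x r)))); last by rewrite lerDl.
  rewrite ler_wpM2l ?ler0n//.
  have : b * (s + dl / 2) <= b * r by rewrite ler_pM2l// ltW.
  lra.
lra.
Unshelve. all: by end_near. Qed.

End ExcursionOde.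
(** * Hausdorff convergence of paths *)

Lemma near_expr_lt {R : realType} (x e : R) : 0 < x < 1 -> 0 < e ->
  \forall n \near \oo, x ^+ n < e.
Proof.
move=> /andP[x0 x1] e0; have := cvg_expr (_ : `|x| < 1).
by rewrite gtr0_norm// => /(_ x1) /cvgr_lt; apply.
Qed.

Lemma half01 {R : realType} : 0 < (2^-1 : R) < 1.
Proof. by rewrite invr_gt0 invf_lt1// ltr0n ltr1n. Qed.

Section ExcursionMetricBounds.
Context {R : realType}.
Implicit Types (e : R -> set R).

Lemma euclidean_dist_same_value (t s v : R) :
  euclidean_dist (t, v) (s, v) = `|t - s|.
Proof. by rewrite /euclidean_dist /= subrr expr0n addr0 sqrtr_sqr. Qed.

(** Partners share the value, so their distance is a time difference. If [s > t0], the point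
    [(t0, v)] of the vertical line replaces [(s, v)] and is closer, as [t <= t0 < s]. *)
Lemma excess_graph_le (t0 dl : R) e1 e2 : 0 <= dl ->
  (forall t v, 0 <= t <= t0 -> e1 t v ->
    exists s, [/\ 0 <= s, `|t - s| <= dl & e2 s v]) ->
  (excess (graph_upto_star t0 e1) (graph_upto_star t0 e2) <= dl%:E)%E.
Proof.
move=> dl0 e12; apply: ge_ereal_sup => _ [[t v] /= + <-].
have close (q : R * R) : graph_upto_star t0 e2 q -> euclidean_dist (t, v) q <= dl ->
    (ereal_inf [set (euclidean_dist (t, v) q)%:E | q in graph_upto_star t0 e2]
     <= dl%:E)%E.
  move=> Gq qdl; apply: le_trans (_ : ((euclidean_dist (t, v) q)%:E <= _)%E).
    by apply: ereal_inf_lbound; exists q.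
  by rewrite lee_fin.
case=> [[/= t0t tv]|/= tE]; last first.
  apply: (close (t, v)); first by right.
  by rewrite euclidean_dist_same_value subrr normr0.
have [s [s0 ts sv]] := e12 t v t0t tv.
have [st0|t0s] := leP s t0.
  apply: (close (s, v)); first by left; rewrite /graph_upto/= s0 st0.
  by rewrite euclidean_dist_same_value.
apply: (close (t0, v)); first by right.
rewrite euclidean_dist_same_value (le_trans _ ts)//.
case/andP: t0t => _ tt0.
by rewrite ler0_norm ?subr_le0// ler0_norm; lra.
Qed.

Lemma dE_cvg0 (e : nat -> R -> set R) (e0 : R -> set R) :
  (forall (k : nat) (dl : R), 0 < dl ->
    \forall n \near \oo, (dE_upto k%:R (e n) e0 <= dl%:E)%E) ->
  dE (e n) e0 @[n --> \oo] --> (0 : \bar R)%E.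
Proof.
move=> he.
have min_ge0 n k : (0 <= Order.min 1 (dE_upto k%:R (e n) e0))%E.
  rewrite le_min lee01/=.
  rewrite /dE_upto /hausdorff_dist le_max; apply/orP; left.
  apply: le_trans (_ : (ereal_inf _ <= _)%E); last first.
    by apply: ereal_sup_ubound; exists (k%:R, 0) => //; right.
  by apply: le_ereal_inf_tmp => _ [q _ <-]; rewrite lee_fin sqrtr_ge0.
have term_ge0 n k : (0 <= (2 ^- k)%R%:E * Order.min 1 (dE_upto k%:R (e n) e0))%E.
  by rewrite mule_ge0// lee_fin invr_ge0 exprn_ge0.
(* The bound charges [dl * 2^-k] at every level and adds the sum of [2^-k] over [K < k <= N], where
   only the truncation at 1 is available. This closed form lets the induction on [N] go through. *)
have partial n (K : nat) (dl : R) : 0 < dl ->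
    (forall k, (k <= K)%N -> (dE_upto k%:R (e n) e0 <= dl%:E)%E) ->
    forall N : nat, (\sum_(1 <= k < N.+1) ((2 ^- k)%R%:E * Order.min 1 (dE_upto k%:R (e n) e0))
      <= (dl * (1 - 2 ^- N) + (2 ^- minn N K - 2 ^- N))%:E)%E.
  move=> dl0 hK; elim=> [|N IH].
    by rewrite big_geq// min0n expr0 invr1 !subrr mulr0 addr0.
  rewrite big_nat_recr//=; apply: (le_trans (leeD2r _ IH)).
  have h2 : 2 ^- N.+1 = 2 ^- N / 2 :> R by rewrite exprSr invfM.
  have p2 : 0 < 2 ^- N :> R by rewrite invr_gt0 exprn_gt0.
  have [NK|KN] := ltnP N K.
    rewrite (minn_idPl NK).
    apply: (@le_trans _ _ ((dl * (1 - 2 ^- N) + (2 ^- N - 2 ^- N))%:E + (2 ^- N.+1 * dl)%:E)%E).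
      rewrite leeD2l// EFinM lee_wpmul2l//.
      by rewrite ge_min hK ?orbT.
    rewrite -EFinD lee_fin h2; lra.
  rewrite (minn_idPr (leqW KN)).
  apply: (@le_trans _ _ ((dl * (1 - 2 ^- N) + (2 ^- K - 2 ^- N))%:E + (2 ^- N.+1 * 1)%:E)%E).
    rewrite leeD2l// EFinM lee_wpmul2l//.
    by rewrite ge_min lexx.
  rewrite -EFinD lee_fin h2.
  have : 0 < dl * 2 ^- N by rewrite mulr_gt0.
  lra.
have dE_ge0 n : (0 <= dE (e n) e0)%E by apply: nneseries_ge0.
have dE_le eps : 0 < eps -> \forall n \near \oo, (dE (e n) e0 <= eps%:E)%E.
  move=> eps0.
  have dl0 : 0 < eps / 2 by rewrite divr_gt0.
  have [K HK] : exists K : nat, 2 ^- K <= eps / 2.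
    have [K _ /(_ K (leqnn K)) /= h] := near_expr_lt _ _ half01 dl0.
    by exists K; rewrite -exprVn ltW.
  have : \forall n \near \oo, forall k, (k <= K)%N -> (dE_upto k%:R (e n) e0 <= (eps / 2)%:E)%E.
    elim: (K) => [|m IH].
      by apply: filterS (he 0%N _ dl0) => n h k; rewrite leqn0 => /eqP->.
    apply: filterS2 IH (he m.+1 _ dl0) => n h1 h2 k.
    by rewrite leq_eqVlt => /predU1P[->//|]; rewrite ltnS; exact: h1.
  apply: filterS => n hK; apply: lime_le.
    exact: is_cvg_nneseries.
  near=> N; have N0 : (0 < N)%N by near: N; exact: nbhs_infty_gt.
  rewrite -(prednK N0); apply: (le_trans (partial _ _ _ dl0 hK _)).
  rewrite lee_fin.
  have p2 : 0 < 2 ^- N.-1 :> R by rewrite invr_gt0 exprn_gt0.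
  have : 2 ^- minn N.-1 K - 2 ^- N.-1 <= eps / 2 :> R.
    have [NK|KN] := leqP N.-1 K; first by rewrite subrr ltW.
    lra.
  have : 0 < eps / 2 * 2 ^- N.-1 by rewrite mulr_gt0.
  lra.
have dE_fin : \forall n \near \oo, dE (e n) e0 \is a fin_num.
  by apply: filterS (dE_le 1 ltr01) => n h; rewrite ge0_fin_numE// (le_lt_trans h) ?ltry.
apply/fine_cvgP; split=> //; apply/cvgrPdist_le => eps eps0.
apply: filterS2 dE_fin (dE_le eps eps0) => n fn h /=.
by rewrite sub0r normrN ger0_norm ?fine_ge0// -lee_fin fineK.
Unshelve. all: by end_near. Qed.

End ExcursionMetricBounds.

(** * Comparison of the two graphs along one path *)

Section PathwiseExcursion.
Context {R : realType}.
Variables (f : R -> R) (b c : R) (E : R -> R) (X : nat -> R -> R).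
Hypotheses (b_gt0 : 0 < b) (c_ge0 : 0 <= c) (f_cont : continuous f) (f0 : f 0 = 0).
Hypothesis f_unbounded : forall A, exists2 y, 0 < y & A < f y.
Hypothesis X0 : forall n, (0 < n)%N -> X n 0 = 0.
Hypothesis X_ge0 : forall n t, (0 < n)%N -> 0 <= t -> 0 <= X n t.
Hypothesis X_ode : forall n t, (0 < n)%N -> 0 <= t ->
  has_derivative_Rplus (X n) t (n%:R * (b * t - f (X n t)) + c).

Let S t := [set E x | x in `[left_limit (passage f b) t, passage f b t]].

(** [reach] says that the solution is at most [dl] late, [running] that it is at most [dl] early. *)
Lemma excursion_dE_upto_le (k : nat) (dl : R) : 0 < dl ->
  \forall n \near \oo, (dE_upto k%:R (fun t => [set E (X n t)]) S <= dl%:E)%E.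
Proof.
move=> dl0.
have bd0 : 0 < b * (dl / 2) * (dl / 2) by rewrite !mulr_gt0 ?divr_gt0.
near=> n.
have n0 : (0 < n)%N by near: n; exact: nbhs_infty_gt.
have nR0 : 0 < n%:R :> R by rewrite ltr0n.
(* By monotonicity of [passage] this single bound serves all [s <= k]. *)
have nK : passage f b k%:R <= n%:R * (b * (dl / 2)) * (dl / 2).
  rewrite -mulrA -ler_pdivrMr//; near: n; exact: nbhs_infty_ger.
have cn : c / n%:R <= b * dl.
  rewrite ler_pdivrMr// mulrC -ler_pdivrMr ?mulr_gt0//; near: n.
  exact: nbhs_infty_ger.
have reach s y : 0 <= s <= k%:R -> y <= passage f b s -> y <= X n (s + dl).
  move=> /andP[s0 sk] ys.
  apply: (@le_trans _ _ (passage f b s)) => //.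
  apply: (ode_reaches f (X n) b c n) => //.
  - exact: X0.
  - by move=> t; exact: X_ge0.
  - by move=> t; exact: X_ode.
  - by move=> z zs; apply: (passage_below f b).
  - by apply: le_trans nK; exact: passage_mono.
have running t z : 0 <= t -> 0 <= z <= X n t -> f z <= b * (t + dl).
  move=> t0 zX; apply: (@le_trans _ _ (b * t + c / n%:R)); last by rewrite mulrDr lerD2l.
  apply: (ode_running_max_le f (X n) b c n) zX => //.
  - exact: X0.
  - by move=> ?; exact: X_ge0.
  - by move=> ?; exact: X_ode.
rewrite /dE_upto /hausdorff_dist ge_max; apply/andP; split; apply: excess_graph_le; rewrite ?(ltW dl0)//.
- move=> t v /andP[t0 tk] ->.
  have Xt0 := X_ge0 n t n0 t0.
  have [s s0 sX] := excursion_interval_cover f b b_gt0 f_cont f0 f_unbounded _ Xt0.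
  exists s; split=> //; last by exists (X n t).
  have [fs [z zX sz]] := (excursion_intervalP f b b_gt0 f_cont f0 f_unbounded _ _ s0 Xt0).1 sX.
  rewrite ler_norml; apply/andP; split.
    by have := le_trans sz (running _ _ t0 zX); rewrite ler_pM2l//; lra.
  (* If [s < t - dl], the running maximum at [X n t] is below [b * (t - dl)], hence
     [X n t < passage (t - dl)], against [reach] at time [t - dl]. *)
  rewrite leNgt; apply/negP => ts.
  have tdl : 0 <= t - dl <= k%:R by apply/andP; split; lra.
  have := reach _ _ tdl (lexx _); rewrite subrK leNgt => /negP; apply.
  apply: passage_gt => // y yX; apply: le_lt_trans (fs _ yX) _.
  by rewrite ltr_pM2l//; lra.
- move=> s v /andP[s0 sk] [y /= + <-]; rewrite in_itv/= => ys.
  have y0 : 0 <= y by case/andP: ys => + _; apply: le_trans; exact: left_limit_passage_ge0.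
  have [fs [z zy sz]] := (excursion_intervalP f b b_gt0 f_cont f0 f_unbounded _ _ s0 y0).1 ys.
  have sdl : 0 <= s + dl by lra.
  have yX : 0 <= y <= X n (s + dl).
    by rewrite y0 reach// ?s0//; case/andP: ys.
  (* The solution visits [y] at some [t <= s + dl]; the running maximum there is at least [b * s]
     and at most [b * (t + dl)]. *)
  have [t /andP[t0 tsd] Xt] := ode_attains f (X n) b c n
    (X0 _ n0) (fun t => X_ode n t n0) _ _ sdl yX.
  exists t; split=> //; last by rewrite Xt.
  rewrite ler_norml; apply/andP; split; first lra.
  have := running t z t0; rewrite Xt => /(_ zy) /(le_trans sz).
  by rewrite ler_pM2l//; lra.
Unshelve. all: by end_near. Qed.

Lemma excursion_dE_cvg :
  dE (fun t => [set E (X n t)]) S @[n --> \oo] --> (0 : \bar R)%E.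
Proof. by apply: dE_cvg0; exact: excursion_dE_upto_le. Qed.

Lemma excursion_interval_valued : continuous E -> interval_valued S.
Proof.
move=> Ec t t0.
have lp := left_limit_passage_le_passage f b b_gt0 f_unbounded t t0.
rewrite /S; set l := left_limit _ _ in lp *; set u := passage _ _ _ in lp *.
have Ew : {within `[l, u], continuous E} by exact: continuous_subspaceT.
have [p + pmax] := EVT_max lp Ew; have [q + qmin] := EVT_min lp Ew.
rewrite !in_itv/= => qlu plu; exists (E q), (E p); split; first by apply: qmin; rewrite in_itv.
apply/seteqP; split=> [_ [x xlu <-] /=|y /=]; rewrite in_itv/=.
  by rewrite qmin// pmax.
move=> /andP[qy yp].
have [pq|qp] := leP p q.
  have [|x xpq Ex] := @IVT _ E p q y pq (continuous_subspaceT Ec).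
    by rewrite ge_min le_max qy yp orbT.
  exists x => //; move: xpq; rewrite /= !in_itv/=; move: plu qlu; lra.
have [|x xpq Ex] := @IVT _ E q p y (ltW qp) (continuous_subspaceT Ec).
  by rewrite ge_min le_max qy yp orbT.
by exists x => //; move: xpq; rewrite /= !in_itv/=; move: plu qlu; lra.
Qed.

End PathwiseExcursion.
(** * The Riemann-Liouville derivative of a Hoelder path *)

Section PowerKernel.
Context {R : realType}.
Notation mu := (@lebesgue_measure R).

Lemma continuous_powR_gt0 (p x : R) : 0 < x -> {for x, continuous (fun r : R => r `^ p)}.
Proof.
move=> x0; apply: differentiable_continuous; apply/derivable1_diffP.
by case: (@is_derive1_powR _ p x x0).
Qed.

(** Positive [p] serves integrability at 0, [p = - al] the tails of the kernel. *)
Lemma integral_powR_segment (p u v : R) : p != 0 -> 0 < u -> u < v ->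
  (\int[mu]_(r in `[u, v]) (r `^ (p - 1))%:E = ((v `^ p - u `^ p) / p)%:E)%E.
Proof.
move=> p0 u0 uv.
have cp q : {within `[u, v], continuous (fun r : R => r `^ q)}.
  apply: continuous_in_subspaceT => r; rewrite inE/= in_itv/= => /andP[ur _].
  by apply: continuous_powR_gt0; rewrite (lt_le_trans u0).
pose F := p^-1 \*: (fun r : R => r `^ p).
have dp (x : R) : u < x -> is_derive x 1 F (x `^ (p - 1)).
  move=> ux; have x0 : 0 < x by exact: lt_trans ux.
  have -> : x `^ (p - 1) = p^-1 *: (p * x `^ (p - 1)) by rewrite -[RHS]/(p^-1 * _) mulKf.
  by rewrite /F; apply: is_deriveZ; exact: is_derive1_powR.
have FE x : F x = x `^ p / p by rewrite mulrC.
rewrite (@continuous_FTC2 _ _ F) ?mulrBl ?FE//.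
- have := cp p; move/(continuous_within_itvP _ uv) => [_ cu cv].
  split.
  + by move=> x; rewrite in_itv/= => /andP[ux _]; case: (dp _ ux).
  + by apply: cvgZr; exact: cu.
  + by apply: cvgZr; exact: cv.
- move=> x; rewrite in_itv/= => /andP[ux _]; rewrite derive1E.
  by case: (dp _ ux).
Qed.

Lemma integrable_powR (p M : R) : 0 < p -> 0 < M ->
  mu.-integrable `]0, M[ (fun r => (r `^ (p - 1))%:E) /\
  \int[mu]_(r in `]0, M[) r `^ (p - 1) <= M `^ p / p.
Proof.
move=> p0 M0.
pose g : R -> \bar R := EFin \o (fun r : R => r `^ (p - 1)).
have mg (D : set R) : measurable_fun D (fun r : R => r `^ (p - 1)).
  by apply: measurable_funTS; exact: measurable_powR.
have g0 r : (0 <= g r)%E by rewrite lee_fin powR_ge0.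
(* [n.+2] keeps the left end strictly below [M], as [integral_powR_segment] requires. *)
pose F (n : nat) : set R := `[M / n.+2%:R, M]%classic.
have n2 (n : nat) : M / n.+2%:R < M.
  by rewrite ltr_pdivrMr// ltr_pMr// ltr1n.
have Fcup : \bigcup_n F n = `]0, M]%classic.
  apply/seteqP; split=> [r [n _]|r]; rewrite /F /= !in_itv/= => /andP[r1 r2].
    by rewrite r2 andbT (lt_le_trans _ r1)// divr_gt0.
  have [n Mn] : exists n : nat, M / r < n%:R.
    by exists (Num.truncn (M / r)).+1; rewrite truncnS_gt.
  exists n => //; rewrite /F /= in_itv/= r2 andbT ler_pdivrMr// mulrC -ler_pdivrMr//.
  by rewrite (le_trans (ltW Mn))// ler_nat ltnW.
have le_int : (\int[mu]_(r in `]0%R, M]) g r <= (M `^ p / p)%:E)%E.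
  rewrite -Fcup.
  have cvgF : (\int[mu]_(x in F i) g x)%E @[i --> \oo] --> (\int[mu]_(x in \bigcup_i F i) g x)%E.
    apply: ge0_nondecreasing_set_cvg_integral => //.
    - move=> m n mn; apply/subsetPset => r; rewrite /F/= !in_itv/= => /andP[r1 ->].
      rewrite andbT (le_trans _ r1)// ler_pM2l// lef_pV2 ?posrE//.
      by rewrite ler_nat.
    - by move=> n; exact: measurable_itv.
    - by move=> n; apply/measurable_EFinP; exact: mg.
  rewrite -(cvg_lim _ cvgF)//; apply: lime_le; first by apply/cvg_ex; eexists; exact: cvgF.
  apply: nearW => n; rewrite integral_powR_segment ?gt_eqF// ?divr_gt0//.
  by rewrite lee_fin ler_pM2r ?invr_gt0// gerBl powR_ge0.
have le_int' : (\int[mu]_(r in `]0%R, M[) g r <= (M `^ p / p)%:E)%E.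
  rewrite integral_itv_bndo_bndc//; apply/measurable_EFinP; exact: mg.
have intg : mu.-integrable `]0%R, M[ g.
  apply/integrableP; split; first by apply/measurable_EFinP; exact: mg.
  under eq_integral do rewrite gee0_abs//.
  by rewrite (le_lt_trans le_int')// ltry.
split => //; rewrite /Rintegral -lee_fin fineK//.
exact: integrable_fin_num.
Qed.

(** The layer-cake identity, to be used with [v] the distance [y - u] to the singularity. *)
Lemma integral_powR_tail (al v M : R) : 0 < al -> 0 < v -> v <= M ->
  (\int[mu]_(r in `]v, M[) (al * r `^ (- al - 1))%:E = (v `^ (- al) - M `^ (- al))%:E)%E.
Proof.
move=> al0 v0; rewrite le_eqVlt => /predU1P[<-|vM].
  by rewrite set_itv_ge ?bnd_simp ?ltxx// integral_set0 subrr.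
have mp q (D : set R) : measurable_fun D (fun r : R => r `^ q).
  by apply: measurable_funTS; exact: measurable_powR.
under eq_integral do rewrite EFinM.
rewrite ge0_integralZl_EFin//.
- rewrite integral_itv_bndo_bndc; last by apply/measurable_EFinP; exact: mp.
  rewrite integral_itv_obnd_cbnd; last by apply/measurable_EFinP; exact: mp.
  rewrite integral_powR_segment// ?oppr_eq0 ?gt_eqF// -EFinM; congr EFin.
  by field; rewrite gt_eqF.
- by move=> r _; rewrite lee_fin powR_ge0.
- by apply/measurable_EFinP; exact: mp.
- exact: ltW.
Qed.

End PowerKernel.

(** * Exchange of the integrations over positions and lags *)

Section LayerFubini.
Context {R : realType}.
Notation mu := (@lebesgue_measure R).
Variables (w k : R -> R) (B M y : R).
Hypotheses (w_cont : continuous w) (k_meas : measurable_fun [set: R] k).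
Hypotheses (k_ge0 : forall r, 0 <= k r) (w_bounded : forall u, `|w u| <= B).
Hypothesis kr_int : mu.-integrable `]0, M[ (EFin \o (fun r => k r * r)).

Let layer (u r : R) := [&& 0 < r, r < M, y - r < u & u < y].

(** [z.1] is a position, [z.2] a lag. Extension by 0 off the layer lets both iterated integrals run
    over the whole line. *)
Definition layer_fun (z : measurableTypeR R * measurableTypeR R) : R :=
  if [&& 0 < z.2, z.2 < M, y - z.2 < z.1 & z.1 < y] then w z.1 * k z.2 else 0.

Local Notation h := layer_fun.

Let w_meas : measurable_fun [set: R] w.
Proof. exact: continuous_measurable_fun. Qed.

Let h_meas : measurable_fun setT h.
Proof.
have m1 := @measurable_fst _ _ (measurableTypeR R) (measurableTypeR R).
have m2 := @measurable_snd _ _ (measurableTypeR R) (measurableTypeR R).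
apply: measurable_fun_ifT.
- apply: measurable_and; first exact: measurable_fun_ltr.
  apply: measurable_and; first exact: measurable_fun_ltr.
  apply: measurable_and; last exact: measurable_fun_ltr.
  by apply: measurable_fun_ltr => //; exact: measurable_funB.
- by apply: measurable_funM; [exact: (measurableT_comp w_meas)|exact: (measurableT_comp k_meas)].
- exact: measurable_cst.
Qed.

Let layerE (u r : R) : layer u r = (r \in `]0, M[) && (u \in `]y - r, y[).
Proof. by rewrite /layer !in_itv/= -!andbA. Qed.

(** At lag [r] the positions fill an interval of length [r]; this factor compensates the singularity
    of [k] at 0. *)
Let int_slice_norm_le (r : R) :
  (\int[mu]_u `|(h (u, r))%:E| <= ((fun r => (B * (k r * r))%:E) \_ `]0%R, M[) r)%E.
Proof.
rewrite patchE; case: ifPn => [|rM]; last first.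
  rewrite mem_setE in rM.
  under eq_integral => u _.
    rewrite /layer_fun /= -/(layer _ _) layerE (negbTE rM)/= normr0. over.
  by rewrite integral0.
rewrite mem_setE => rM; have /andP[r0 _] : 0 < r < M by move: rM; rewrite in_itv.
apply: (@le_trans _ _ (\int[mu]_(u in `](y - r)%R, y[) (cst (B * k r)%:E u))%E); last first.
  rewrite integral_cst//= lebesgue_measure_itv/= lte_fin ltrBlDr ltrDl r0.
  by rewrite -EFinB -EFinM lee_fin subKr mulrA.
rewrite [leRHS]integral_mkcond/=; apply: ge0_le_integral => //=.
- by apply/measurable_EFinP/measurableT_comp => //; exact: (measurableT_comp h_meas (measurable_pair2 _)).
- by apply/(measurable_restrictT _ _).1 => //; exact: measurable_itv.
- move=> u _; rewrite /layer_fun/= -/(layer _ _) layerE rM/= patchE mem_setE.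
  case: ifPn => _; last by rewrite normr0.
  by rewrite lee_fin normrM (ger0_norm (k_ge0 r)) ler_wpM2r.
Qed.

Let mI : measurable (`]0, M[%classic : set (measurableTypeR R)).
Proof. exact: measurable_itv. Qed.

(** Absolute integrability is tested with positions innermost, the order in which the factor [r] is
    gained. *)
Let h_int : (mu \x mu)%E.-integrable setT (EFin \o h).
Proof.
apply/integrable21ltyP; first exact/measurable_EFinP.
have BI : mu.-integrable `]0, M[ (fun r => (B * (k r * r))%:E).
  exact: (integrableZl mI B kr_int).
apply: (@le_lt_trans _ _ (\int[mu]_r ((fun r => (B * (k r * r))%:E) \_ `]0%R, M[) r)%E).
  apply: ge0_le_integral => //=.
  - by move=> r _; apply: integral_ge0.
  - apply: (measurable_fun_fubini_tonelli_G (fun z => `|(EFin \o h) z|%E)) => //.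
    by apply: measurableT_comp => //; exact/measurable_EFinP.
  - apply/(measurable_restrictT _ _).1; first exact: measurable_itv.
    by have /integrableP[] := BI.
  - by move=> r _; exact: int_slice_norm_le.
by have := integrable_lty mI BI; rewrite integral_mkcond.
Qed.

Lemma layer_fubini :
  mu.-integrable setT (fun u => \int[mu]_r (h (u, r))%:E)%E /\
  (\int[mu]_u \int[mu]_r (h (u, r))%:E = \int[mu]_r \int[mu]_u (h (u, r))%:E)%E.
Proof. by split; [exact: integrable_fubini_F h_int | exact: Fubini h_int]. Qed.

(** [u < y] keeps the lags away from 0, so that [k] alone can be integrable; positions where [w]
    vanishes need no such control. *)
Lemma layer_slice_position (u : R) : u < y -> (0 < u -> y - u < M) ->
  (w u != 0 -> 0 < u) ->
  (0 < u -> mu.-integrable `]y - u, M[ (EFin \o k)) ->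
  (\int[mu]_r (h (u, r))%:E =
   (w u)%:E * \int[mu]_(r in `](y - u)%R, M[) (k r)%:E)%E.
Proof.
move=> uy uM w0 ki.
have [wu|wu] := eqVneq (w u) 0.
  rewrite wu mul0e; under eq_integral => r _ do rewrite /layer_fun /= wu mul0r if_same.
  by rewrite integral0.
rewrite -integralZl//; last exact: ki (w0 wu).
rewrite [RHS]integral_mkcond; apply: eq_integral => r _.
rewrite patchE mem_setE /layer_fun /= in_itv/=.
have := uM (w0 wu) => uM'.
rewrite ltrBlDr -ltrBlDl uy andbT.
have [yur|] := ltP (y - u) r; last by rewrite !andbF.
by rewrite (lt_trans _ yur) ?subr_gt0// andbT /=; case: ifPn.
Qed.

Lemma layer_slice_lag (r : R) :
  (\int[mu]_u (h (u, r))%:E =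
   ((fun r => (k r * \int[mu]_(u in `](y - r)%R, y[) w u)%:E) \_ `]0%R, M[) r)%E.
Proof.
rewrite patchE mem_setE; case: ifPn => rM; last first.
  under eq_integral => u _ do rewrite /layer_fun /= -/(layer _ _) layerE (negbTE rM).
  by rewrite integral0.
have wi : mu.-integrable `]y - r, y[ (EFin \o w).
  apply: (@integrableS _ _ _ mu `[y - r, y]) => //.
    exact: subset_itv_oo_cc.
  apply: continuous_compact_integrable; first exact: segment_compact.
  exact: continuous_subspaceT.
rewrite EFinM /Rintegral fineK; last exact: integrable_fin_num.
rewrite -integralZl// [RHS]integral_mkcond; apply: eq_integral => u _.
by rewrite patchE mem_setE /h /= -/(layer _ _) layerE rM/=; case: ifPn => // _; rewrite mulrC.
Qed.

End LayerFubini.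
Section HolderPaths.
Context {R : realType}.

Lemma holder_continuous (w : R -> R) (C lam : R) : 0 < lam ->
  (forall s t, `|w s - w t| <= C * `|s - t| `^ lam) -> continuous w.
Proof.
move=> lam0 hw x; apply/cvgrPdist_lt => e e0.
have C0 : 0 <= C.
  by have := hw 1 0; rewrite subr0 normr1 powR1 mulr1; apply: le_trans.
have C1 : 0 < C + 1 by rewrite ltr_wpDl.
have d0 : 0 < (e / (C + 1)) `^ lam^-1 by rewrite powR_gt0// divr_gt0.
apply/nbhs_ballP; exists ((e / (C + 1)) `^ lam^-1) => //= y; rewrite /ball/= => xy.
apply: (le_lt_trans (hw _ _)).
have : `|x - y| `^ lam < e / (C + 1).
  have := gt0_ltr_powR lam0 _ _ xy.
  by rewrite !nnegrE normr_ge0 powR_ge0 -powRrM mulVf ?gt_eqF// powRr1 ?divr_ge0 ?ltW// => ->.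
rewrite ltr_pdivlMr// mulrC; apply: le_lt_trans.
by rewrite ler_wpM2r ?powR_ge0// lerDl.
Qed.

End HolderPaths.

(** * Weyl form of the fractional derivative *)

Section WeylRepresentation.
Context {R : realType}.
Notation mu := (@lebesgue_measure R).
Variables (w : R -> R) (C B lam al M : R).
Hypotheses (al0 : 0 < al) (al_lam : al < lam) (al1 : al < 1) (M0 : 0 < M).
Hypothesis w_holder : forall s t, `|w s - w t| <= C * `|s - t| `^ lam.
Hypothesis w_neg : forall u, u <= 0 -> w u = 0.
Hypothesis w_bounded : forall u, `|w u| <= B.

Let lam0 : 0 < lam := lt_trans al0 al_lam.

Let w_cont : continuous w := @holder_continuous R w C lam lam0 w_holder.

Let w_int (x y : R) : mu.-integrable `[x, y] (EFin \o w).
Proof.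
apply: continuous_compact_integrable; first exact: segment_compact.
exact: continuous_subspaceT.
Qed.

Let w_int_oo (x y : R) : mu.-integrable `]x, y[ (EFin \o w).
Proof.
apply: (@integrableS _ _ _ mu `[x, y]) => //.
exact: subset_itv_oo_cc.
Qed.

(** Lies to the left of every [y - r] with [-1 < y] and [0 < r < M], so the primitive [V] is
    differentiable at all of them. *)
Let a0 := - (M + 2).

Let V y := \int[mu]_(t in `[a0, y]) w t.

Let V_is_derive x : a0 < x -> is_derive x 1 V (w x).
Proof.
move=> ax.
have x1 : x < x + 1 by rewrite ltrDl.
have [dV V'] := @continuous_FTC1 _ w (BLeft a0) x (x + 1) x1 (w_int _ _) ax (w_cont x).
by apply: DeriveDef => //; rewrite -derive1E.
Qed.

Let V_sub x y : a0 <= x -> x <= y -> V y - V x = \int[mu]_(t in `]x, y]) w t.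
Proof. by move=> ax xy; rewrite /V Rintegral_itvB. Qed.

Let V_mvt x y : a0 < x -> x <= y -> exists2 z, x <= z <= y & V y - V x = w z * (y - x).
Proof.
move=> ax xy.
have dV z : z \in `]x, y[ -> is_derive z 1 V (w z).
  by rewrite in_itv/= => /andP[xz _]; apply: V_is_derive; exact: lt_trans xz.
have cV : {within `[x, y], continuous V}.
  apply: derivable_within_continuous => z; rewrite in_itv/= => /andP[xz _].
  by case: (V_is_derive z (lt_le_trans ax xz)).
have [z + ->] := MVT_segment xy dV cV.
by rewrite in_itv/= => zxy; exists z.
Qed.

Let V_lip x y : a0 < x -> x <= y -> `|V y - V x| <= B * (y - x).
Proof.
move=> ax xy; have [z _ ->] := V_mvt _ _ ax xy.
by rewrite normrM ler_pM// ger0_norm// subr_ge0.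
Qed.

Let V_continuous x : a0 < x -> {for x, continuous V}.
Proof.
move=> ax; apply: differentiable_continuous; apply/derivable1_diffP.
by case: (V_is_derive _ ax).
Qed.

Let kern r := al * r `^ (- al - 1).

Let kern_ge0 r : 0 <= kern r.
Proof. by rewrite mulr_ge0 ?powR_ge0// ltW. Qed.

Let kern_measurable (D : set R) : measurable_fun D kern.
Proof.
apply: measurable_funM => //.
by apply: measurable_funTS; exact: measurable_powR.
Qed.

Let kernM r p : 0 < r -> kern r * r `^ p = al * r `^ ((p - al) - 1).
Proof.
move=> r0; rewrite /kern -mulrA -powRD; last by rewrite (gt_eqF r0) implybT.
by congr (_ * _ `^ _); lra.
Qed.

Let mI : measurable (`]0, M[%classic : set (measurableTypeR R)).
Proof. exact: measurable_itv. Qed.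

Let kern_powR_int p : al < p ->
  mu.-integrable `]0, M[ (EFin \o (fun r => al * r `^ ((p - al) - 1))).
Proof.
move=> alp; have p0 : 0 < p - al by rewrite subr_gt0.
have [ip _] := integrable_powR _ _ p0 M0.
exact: (integrableZl mI al ip).
Qed.

(** The product has order [p - al - 1 > -1] at 0. Used with [p = 1] for increments of the Lipschitz
    [V], with [p = lam] for those of [w]. *)
Let kern_dominated (g : R -> R) (K p : R) : al < p ->
  {in `]0, M[, continuous g} -> (forall r, 0 < r < M -> `|g r| <= K * r `^ p) ->
  mu.-integrable `]0, M[ (EFin \o (fun r => kern r * g r)).
Proof.
move=> alp gc gK.
apply: (@le_integrable _ _ _ mu _ _ _ (EFin \o (fun r => K * (al * r `^ ((p - al) - 1))))) => //.
- apply/measurable_EFinP/measurable_funM; first exact: kern_measurable.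
  by apply: open_continuous_measurable_fun => // r; rewrite inE => /gc.
- move=> r /=; rewrite in_itv/= => rM; rewrite lee_fin.
  have /andP[r0 _] := rM; rewrite -kernM//.
  rewrite normrM (ger0_norm (kern_ge0 r)) mulrCA [leRHS]ger0_norm.
    by rewrite ler_wpM2l ?gK.
  by rewrite mulr_ge0// (le_trans _ (gK r rM)).
- exact: (integrableZl mI K (kern_powR_int _ alp)).
Qed.

(** [H] is the singular part of the fractional integral and [D] its formal derivative: increments of
    [V] become increments of [w]. *)
Let H y := \int[mu]_(r in `]0, M[) (kern r * (V y - V (y - r))).
Let D y := \int[mu]_(r in `]0, M[) (kern r * (w y - w (y - r))).

Let H_int (y : R) : -1 < y -> mu.-integrable `]0, M[ (EFin \o (fun r => kern r * (V y - V (y - r)))).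
Proof.
move=> y1; apply: (kern_dominated _ B 1) => //.
- move=> r; rewrite in_itv/= => /andP[r0 rM].
  apply: cvgB; first exact: cvg_cst.
  apply: (@continuous_comp _ _ _ (fun r => y - r) V).
    by apply: cvgB; [exact: cvg_cst | exact: cvg_id].
  by apply: V_continuous; rewrite /a0; lra.
- move=> r /andP[r0 rM]; rewrite (powRr1 (ltW r0)).
  rewrite -[X in B * X](subKr y); apply: V_lip; last by rewrite lerBlDr lerDl ltW.
  by rewrite /a0; lra.
Qed.

Let D_bound (y r : R) : 0 < r -> `|w y - w (y - r)| <= C * r `^ lam.
Proof.
move=> r0; apply: (le_trans (w_holder _ _)).
by rewrite subKr gtr0_norm.
Qed.

Let D_int y : mu.-integrable `]0, M[ (EFin \o (fun r => kern r * (w y - w (y - r)))).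
Proof.
apply: (kern_dominated _ C lam) => //.
- move=> r _; apply: cvgB; first exact: cvg_cst.
  apply: (@continuous_comp _ _ _ (fun r => y - r) w); last exact: w_cont.
  by apply: cvgB; [exact: cvg_cst | exact: cvg_id].
- by move=> r /andP[r0 _]; exact: D_bound.
Qed.

Let C0 : 0 <= C.
Proof.
by have := w_holder 1 0; rewrite subr0 normr1 powR1 mulr1; apply: le_trans.
Qed.

(** Dominates the integrand of [D] uniformly in [y]; integrable because [al < lam]. *)
Let G r := C * (al * r `^ ((lam - al) - 1)).

Let G_int : mu.-integrable `]0, M[ (EFin \o G).
Proof. exact: (integrableZl mI C (kern_powR_int _ al_lam)). Qed.

Let D_dominated (y r : R) : 0 < r < M -> `|kern r * (w y - w (y - r))| <= G r.
Proof.
move=> /andP[r0 rM]; rewrite /G -kernM// mulrCA normrM (ger0_norm (kern_ge0 r)).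
by rewrite ler_wpM2l ?D_bound.
Qed.

Let H_partial (y r : R) : -1 < y -> 0 < r < M ->
  is_derive y 1 (fun y => kern r * (V y - V (y - r))) (kern r * (w y - w (y - r))).
Proof.
move=> y1 /andP[r0 rM].
have d1 : is_derive y 1 V (w y) by apply: V_is_derive; rewrite /a0; lra.
have d2 : is_derive (y - r) 1 V (w (y - r)) by apply: V_is_derive; rewrite /a0; lra.
have d3 : is_derive y 1 (fun y => V (y - r)) (w (y - r)).
  rewrite -[w _]mulr1; apply: (@is_derive1_comp _ V (shift (- r)) y) => //.
  exact: is_derive_shift.
exact: (is_deriveZ (kern r) (is_deriveB d1 d3)).
Qed.

Let H_is_derive (y : R) : -1 < y -> is_derive y 1 H (D y).
Proof.
move=> y1.
have yI : y \in `]-1, y + 1[ by rewrite in_itv/= y1 ltrDl ltr01.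
have Hd (x r : R) : `]-1, y + 1[%classic x -> `]0, M[%classic r ->
    is_derive x 1 (fun y => kern r * (V y - V (y - r))) (kern r * (w x - w (x - r))).
  by rewrite /= !in_itv/= => /andP[x1 _] rM; exact: H_partial.
have H1 (x : R) : `]-1, y + 1[%classic x -> mu.-integrable `]0, M[ (EFin \o (fun r => kern r * (V x - V (x - r)))).
  by rewrite /= in_itv/= => /andP[x1 _]; exact: H_int.
have H2 (x r : R) : `]-1, y + 1[%classic x -> `]0, M[%classic r ->
    derivable (fun y => kern r * (V y - V (y - r))) x 1.
  by move=> xI rI; case: (Hd x r xI rI).
have part (x r : R) : `]-1, y + 1[%classic x -> `]0, M[%classic r ->
    partial1of2 (fun y r => kern r * (V y - V (y - r))) x r = kern r * (w x - w (x - r)).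
  by move=> xI rI; rewrite partial1of2E; case: (Hd x r xI rI).
have G0 (r : R) : 0 <= G r by rewrite /G !mulr_ge0 ?powR_ge0// ltW.
have HG (x r : R) : `]-1, y + 1[%classic x -> `]0, M[%classic r ->
    `|partial1of2 (fun y r => kern r * (V y - V (y - r))) x r| <= G r.
  by move=> xI rI; rewrite part//; apply: D_dominated; move: rI; rewrite /= in_itv.
apply: DeriveDef.
  by apply: (derivable_under_integral mI yI H1 H2 G0 G_int HG).
rewrite -derive1E (differentiation_under_integral mI yI H1 H2 G0 G_int HG).
by apply: eq_Rintegral => r; rewrite inE => rI; exact: part.
Qed.

Let D_continuous : continuous D.
Proof.
move=> y.
have yI : y \in `]y - 1, y + 1[%classic by rewrite inE/= in_itv/=; lra.
apply: (@continuity_under_integral _ _ _ mu (fun y r => kern r * (w y - w (y - r)))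
  `]0, M[%classic mI (y - 1) (y + 1) _ _ G G_int _ y yI).
- by move=> x _; exact: D_int.
- apply: aeW => r _ x _; apply: cvgM; first exact: cvg_cst.
  apply: cvgB; first exact: w_cont.
  apply: (@continuous_comp _ _ _ (fun x => x - r) w); last exact: w_cont.
  by apply: cvgB; [exact: cvg_id | exact: cvg_cst].
- move=> x _; apply: aeW => r; rewrite /= in_itv/= => rM.
  exact: D_dominated.
Qed.

Let D_le y : `|D y| <= C * al / (lam - al) * M `^ (lam - al).
Proof.
have p0 : 0 < lam - al by rewrite subr_gt0.
apply: (le_trans (le_normr_Rintegral _ (D_int y))) => //.
apply: (@le_trans _ _ (\int[mu]_(r in `]0, M[) G r)).
  apply: le_Rintegral => //.
    exact: (integrable_norm (D_int y)).
  by move=> r; rewrite /= in_itv/= => rM; exact: D_dominated.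
have [ip le_p] := integrable_powR _ _ p0 M0.
rewrite /G RintegralZl//; last exact: kern_powR_int.
rewrite RintegralZl// -!mulrA ler_wpM2l// ler_wpM2l ?(ltW al0)//.
by rewrite mulrC.
Qed.

Let V_neg y : y <= 0 -> V y = 0.
Proof.
move=> y0; rewrite /V (@eq_Rintegral _ _ _ mu _ (cst 0)).
  by rewrite Rintegral_cst//= mul0r.
move=> u; rewrite inE/= in_itv/= => /andP[_ uy]; apply: w_neg.
exact: le_trans y0.
Qed.

Let H_neg y : y <= 0 -> H y = 0.
Proof.
move=> y0; rewrite /H (@eq_Rintegral _ _ _ mu _ (cst 0)).
  by rewrite Rintegral_cst//= mul0r.
move=> r; rewrite inE/= in_itv/= => /andP[r0 _].
have yr : y - r <= 0 by lra.
by rewrite !V_neg// subrr mulr0.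
Qed.

Let kern_tail_int v : 0 < v -> v <= M -> mu.-integrable `]v, M[ (EFin \o kern).
Proof.
move=> v0 vM; apply/integrableP; split.
  by apply/measurable_EFinP; exact: kern_measurable.
under eq_integral => r _.
  rewrite /= (ger0_norm (kern_ge0 r)). over.
by rewrite integral_powR_tail// ltry.
Qed.

Let I y := \int[mu]_(u in `[0, y]) (w u / (y - u) `^ al).

(* Layer-cake: on the support of [w], [(y - u)^-al] is [M^-al] plus the integral
   of [al * r^(-1-al)] over [y - u < r < M]. *)
Let I_rep y : y < M -> I y = M `^ (- al) * V y + H y.
Proof.
move=> yM; have [y0|y0] := leP y 0.
  rewrite V_neg// H_neg// mulr0 addr0 /I (@eq_Rintegral _ _ _ mu _ (cst 0)).
    by rewrite Rintegral_cst//= mul0r.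
  move=> u; rewrite inE/= in_itv/= => /andP[_ uy].
  by rewrite w_neg ?mul0r// (le_trans uy).
have kr_int : mu.-integrable `]0, M[ (EFin \o (fun r => kern r * r)).
  apply: (kern_dominated _ 1 1) => //; first by move=> r _; exact: cvg_id.
  by move=> r /andP[r0 _]; rewrite mul1r powRr1 ?(ltW r0)// gtr0_norm.
have [l_int l_eq] := layer_fubini w kern B M y w_cont (kern_measurable setT)
  kern_ge0 w_bounded kr_int.
(* The integrand of [I y] without its [M^-al] part; on []0, y[] it is the integral of the layer
   function over the lags. *)
pose J u := w u * ((y - u) `^ (- al) - M `^ (- al)).
set L := (fun u => _) in l_int.
have LE : L = (EFin \o J) \_ `]0, y[.
  apply/funext => u; rewrite /L patchE mem_setE in_itv/=.
  have [uy|yu] := ltP u y; last first.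
    rewrite andbF; under eq_integral => r _.
      rewrite /layer_fun/= [u < y]ltNge yu/= !andbF. over.
    by rewrite integral0.
  have yuM : 0 < u -> y - u < M by move=> u0; lra.
  have wu0 : w u != 0 -> 0 < u by move=> wu; rewrite ltNge; apply: contra wu => /w_neg ->.
  have ki : 0 < u -> mu.-integrable `]y - u, M[ (EFin \o kern).
    by move=> u0; apply: kern_tail_int; lra.
  rewrite (layer_slice_position _ _ _ _ _ uy yuM wu0 ki) andbT.
  have [u0|u0] := ltP 0 u; last by rewrite (w_neg _ u0) mul0e.
  have yu0 : 0 < y - u by rewrite subr_gt0.
  by rewrite (integral_powR_tail _ _ _ al0 yu0 (ltW (yuM u0))).
have mY : measurable (`]0, y[%classic : set (measurableTypeR R)) by exact: measurable_itv.
have J_int : mu.-integrable `]0, y[ (EFin \o J).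
  by apply/(integrable_mkcond _ mY); rewrite -LE.
(* With positions innermost, the integral of [w] over []y - r, y[] is [V y - V (y - r)]. *)
have J_eq : \int[mu]_(u in `]0, y[) J u = H y.
  rewrite /Rintegral [in LHS]integral_mkcond -LE l_eq /H /Rintegral [in RHS]integral_mkcond.
  congr fine; apply: eq_integral => r _.
  rewrite layer_slice_lag; last exact: w_cont.
  rewrite !patchE; case: ifPn => [|_]; last by [].
  rewrite mem_setE in_itv/= => /andP[r0 rM].
  have a0r : a0 <= y - r by rewrite /a0; lra.
  have yr : y - r <= y by lra.
  rewrite (V_sub _ _ a0r yr) Rintegral_itv_bndo_bndc; first by [].
  exact: w_int_oo.
have w_int' : mu.-integrable `]0, y[ (EFin \o w).
  exact: w_int_oo.
have V_eq : V y = \int[mu]_(u in `]0, y[) w u.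
  have a00 : a0 <= 0 by rewrite /a0; lra.
  rewrite Rintegral_itv_bndo_bndc; last first.
    exact: w_int_oo.
  by rewrite -(V_sub _ _ a00 (ltW y0)) (V_neg _ (lexx 0)) subr0.
have Mw_int : mu.-integrable `]0, y[ (EFin \o (fun u => M `^ (- al) * w u)).
  exact: (integrableZl mY _ w_int').
have -> : I y = \int[mu]_(u in `]0, y[) (M `^ (- al) * w u + J u).
  have JE u : w u / (y - u) `^ al = M `^ (- al) * w u + J u.
    by rewrite /J -powRN; ring.
  rewrite /I (@eq_Rintegral _ _ _ mu _ (fun u => M `^ (- al) * w u + J u)); last first.
    by move=> u _; exact: JE.
  rewrite /Rintegral integral_itv_bndoo; first by [].
  apply/measurable_EFinP/measurable_funD.
    by have /integrableP[/measurable_EFinP] := Mw_int.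
  by have /integrableP[/measurable_EFinP] := J_int.
rewrite (RintegralD mY Mw_int J_int) (RintegralZl _ mY w_int') V_eq J_eq.
by [].
Qed.

(** [D0] is [M^-al * w + D], continuous and bounded on the whole line, although it is the derivative
    of the fractional integral only where [I_rep] holds nearby. *)
Lemma weyl_form : exists D0 : R -> R,
  [/\ continuous D0, D0 0 = 0,
   forall z, `|D0 z| <= M `^ (- al) * B + C * al / (lam - al) * M `^ (lam - al) &
   forall z, 0 <= z < M ->
     is_derive z 1 (fun y => \int[mu]_(u in `[0, y]) (w u / (y - u) `^ al)) (D0 z)].
Proof.
exists (fun z => M `^ (- al) * w z + D z); split.
- move=> z; apply: cvgD; last exact: D_continuous.
  by apply: cvgM; [exact: cvg_cst | exact: w_cont].
- rewrite w_neg// mulr0 add0r /D (@eq_Rintegral _ _ _ mu _ (cst 0)).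
    by rewrite Rintegral_cst//= mul0r.
  move=> r; rewrite inE/= in_itv/= => /andP[r0 _].
  have r1 : 0 - r <= 0 by lra.
  by rewrite !w_neg// subrr mulr0.
- move=> z; apply: (le_trans (ler_normD _ _)); apply: lerD; last exact: D_le.
  by rewrite normrM ger0_norm ?powR_ge0// ler_wpM2l ?powR_ge0.
- move=> z /andP[z0 zM].
  apply: (@near_eq_is_derive _ _ _ (fun y => M `^ (- al) * V y + H y)).
    by near=> y; rewrite -[RHS]/(I y) I_rep//; near: y; exact: lt_nbhsl.
  apply: (@is_deriveD _ _ _ (M `^ (- al) \*: V) H).
    by apply: is_deriveZ; apply: V_is_derive; rewrite /a0; lra.
  by apply: H_is_derive; lra.
Unshelve. all: by end_near. Qed.

End WeylRepresentation.

(** * Fractional derivatives of locally Hoelder paths *)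

Section RiemannLiouville.
Context {R : realType}.
Variables (al lam : R).
Hypotheses (al0 : 0 < al) (al_lam : al < lam) (al1 : al < 1).

Lemma clamp_dist_le (M s t : R) : 0 < M ->
  `|Num.min M (Num.max s 0) - Num.min M (Num.max t 0)| <= `|s - t|.
Proof.
move=> M0.
apply: (@le_trans _ _ `|Num.max s 0 - Num.max t 0|).
  move: (Num.max s 0) (Num.max t 0) => {}s {}t.
  have := ler_norm (s - t); have := ler_norm (t - s); rewrite (distrC t s).
  move: `|s - t| => d; rewrite ler_norml.
  by case: (leP M s) => ?; case: (leP M t) => ?; lra.
have := ler_norm (s - t); have := ler_norm (t - s); rewrite (distrC t s).
move: `|s - t| => d; rewrite ler_norml.
by case: (leP s 0) => ?; case: (leP t 0) => ?; lra.
Qed.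

(** On [[0, M[] the derivative sees [w] on [[0, M]] only, so [w] may be composed with the clamp onto
    [[0, M]]. This keeps the Hoelder constant and yields a path that is 0 at negative arguments and
    bounded by [C * M^lam]. *)
Lemma riemann_liouville_holder (w : R -> R) (C M : R) : 0 < M -> 0 <= C -> w 0 = 0 ->
  (forall s t, 0 <= s <= M -> 0 <= t <= M -> `|w s - w t| <= C * `|s - t| `^ lam) ->
  exists D : R -> R, [/\ continuous D, D 0 = 0,
    forall z, `|D z| <=
      `|(Gamma (1 - al))^-1| * (C * (1 + al / (lam - al)) * M `^ (lam - al)) &
    forall z, 0 <= z < M -> riemann_liouville al w z = D z].
Proof.
move=> M0 C0 w0 hw.
pose cl u := Num.min M (Num.max u 0).
have clP u : 0 <= cl u <= M.
  by rewrite /cl le_min ge_min le_max !lexx (ltW M0) orbT.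
have clE u : 0 <= u <= M -> cl u = u.
  by move=> /andP[u0 uM]; rewrite /cl max_l// min_r.
have lam0 := lt_trans al0 al_lam.
have h_holder s t : `|w (cl s) - w (cl t)| <= C * `|s - t| `^ lam.
  apply: (le_trans (hw _ _ (clP s) (clP t))).
  by rewrite ler_wpM2l// ge0_ler_powR// ?nnegrE ?(ltW lam0)// clamp_dist_le.
have h_neg u : u <= 0 -> w (cl u) = 0.
  by move=> u0; rewrite /cl max_r// min_r ?w0// ltW.
have h_bounded u : `|w (cl u)| <= C * M `^ lam.
  have /andP[u0 uM] := clP u.
  have := hw _ 0 (clP u); rewrite w0 !subr0 lexx (ltW M0) => /(_ isT)/le_trans; apply.
  by rewrite ler_wpM2l// ge0_ler_powR// ?nnegrE ?(ltW lam0) ?(ltW M0)// ger0_norm.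
have [D [Dc D0 Db DP]] := weyl_form _ _ _ _ _ _ al0 al_lam al1 M0 h_holder h_neg h_bounded.
exists (fun z => (Gamma (1 - al))^-1 * D z); split.
- by move=> z; apply: cvgM; [exact: cvg_cst | exact: Dc].
- by rewrite D0 mulr0.
- move=> z; rewrite normrM ler_wpM2l//; apply: (le_trans (Db z)).
  have -> : M `^ (lam - al) = M `^ (- al) * M `^ lam.
    by rewrite -powRD 1?addrC// (gt_eqF M0) implybT.
  have -> : M `^ (- al) * (C * M `^ lam) + C * al / (lam - al) * (M `^ (- al) * M `^ lam) =
    C * (1 + al / (lam - al)) * (M `^ (- al) * M `^ lam) by ring.
  exact: lexx.
- move=> z /andP[z0 zM]; rewrite /riemann_liouville derive1E; congr (_ * _).
  have dz := DP z; rewrite z0 zM in dz.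
  have [_ <-] := dz isT.
  apply: near_eq_derive; near=> y.
  apply: eq_Rintegral => u; rewrite inE/= in_itv/= => /andP[u0 uy].
  rewrite clE// u0 (le_trans uy)// ltW//; near: y; exact: lt_nbhsl.
Unshelve. all: by end_near. Qed.

Variables (w : R -> R) (C a : R).
Hypotheses (C0 : 0 <= C) (w0 : w 0 = 0) (a0 : 0 < a).
Hypothesis w_growth : \forall k \near \oo, forall s t,
  0 <= s <= 2 ^+ k -> 0 <= t <= 2 ^+ k ->
  `|w s - w t| <= C * (2 ^+ k) `^ (1 - lam) * `|s - t| `^ lam.

(** At scale [M = 2^k] the exponents add up to [(1 - lam) + (lam - al)], with one constant for all
    [k]. *)
Let w_local : \forall k \near \oo, exists D : R -> R, [/\ continuous D, D 0 = 0,
    forall z, `|D z| <= `|(Gamma (1 - al))^-1| * (C * (1 + al / (lam - al))) *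
      (2 ^+ k) `^ (1 - al) &
    forall z, 0 <= z < 2 ^+ k -> riemann_liouville al w z = D z].
Proof.
apply: filterS w_growth => k hk.
have M0 : 0 < 2 ^+ k :> R by rewrite exprn_gt0.
have CM0 : 0 <= C * (2 ^+ k) `^ (1 - lam) by rewrite mulr_ge0 ?powR_ge0.
have [D [Dc D0 Db DP]] := riemann_liouville_holder _ _ _ M0 CM0 w0 hk.
exists D; split => // z; apply: (le_trans (Db z)).
have -> : (2 ^+ k) `^ (1 - al) = (2 ^+ k) `^ (1 - lam) * (2 ^+ k) `^ (lam - al) :> R.
  rewrite -powRD; last by rewrite (gt_eqF M0) implybT.
  by congr (_ `^ _); ring.
rewrite le_eqVlt; apply/orP; left; apply/eqP; ring.
Qed.

Let pow2_big (A : R) : \forall k \near \oo, A < 2 ^+ k.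
Proof.
near=> k; apply: (@lt_le_trans _ _ k%:R).
  near: k; exact: nbhs_infty_gtr.
by rewrite -natrX ler_nat ltnW// ltn_expl.
Unshelve. all: by end_near. Qed.

Lemma riemann_liouville_continuous :
  continuous (fun y : R => riemann_liouville al w (Num.max y 0)).
Proof.
move=> y; near \oo => k.
have [D [Dc _ _ DP]] : exists D : R -> R, [/\ continuous D, D 0 = 0,
    forall z, `|D z| <= `|(Gamma (1 - al))^-1| * (C * (1 + al / (lam - al))) *
      (2 ^+ k) `^ (1 - al) &
    forall z, 0 <= z < 2 ^+ k -> riemann_liouville al w z = D z].
  by near: k; exact: w_local.
have yk : y < 2 ^+ k by near: k; exact: pow2_big.
have p0 : 0 < 2 ^+ k :> R by rewrite exprn_gt0.
have E z : z < 2 ^+ k -> riemann_liouville al w (Num.max z 0) = D (Num.max z 0).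
  by move=> zk; apply: DP; rewrite le_max lexx orbT/= gt_max zk.
rewrite /continuous_at E//.
apply: (@cvg_trans _ ((fun z : R => D (Num.max z 0)) @ y)).
  apply: near_eq_cvg; near=> z; rewrite E//; near: z; exact: lt_nbhsl.
have cm : {for y, continuous (fun z : R => Num.max z 0)}.
  by apply: continuous_max; [exact: cvg_id | exact: cvg_cst].
exact: (@continuous_comp R R R (fun z => Num.max z 0) D y cm (Dc _)).
Unshelve. all: by end_near. Qed.

Lemma riemann_liouville_at0 : riemann_liouville al w 0 = 0.
Proof.
near \oo => k.
have [D [_ D0 _ DP]] : exists D : R -> R, [/\ continuous D, D 0 = 0,
    forall z, `|D z| <= `|(Gamma (1 - al))^-1| * (C * (1 + al / (lam - al))) *
      (2 ^+ k) `^ (1 - al) &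
    forall z, 0 <= z < 2 ^+ k -> riemann_liouville al w z = D z].
  by near: k; exact: w_local.
by rewrite DP// lexx exprn_gt0.
Unshelve. all: by end_near. Qed.

Lemma riemann_liouville_sublinear (A : R) :
  exists2 y, 0 < y & A < y - a * riemann_liouville al w y.
Proof.
pose K := `|(Gamma (1 - al))^-1| * (C * (1 + al / (lam - al))).
near \oo => k.
have [D [_ _ Db DP]] : exists D : R -> R, [/\ continuous D, D 0 = 0,
    forall z, `|D z| <= K * (2 ^+ k) `^ (1 - al) &
    forall z, 0 <= z < 2 ^+ k -> riemann_liouville al w z = D z].
  by near: k; exact: w_local.
have p0 : 0 < 2 ^+ k :> R by rewrite exprn_gt0.
have K0 : 0 <= K.
  by rewrite /K !mulr_ge0// addr_ge0// divr_ge0 ?subr_ge0// ltW.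
(* Half the scale, since [D] is known to be the derivative strictly below [2 ^+ k] only. *)
exists (2 ^+ k / 2); first by rewrite divr_gt0.
rewrite DP; last by apply/andP; split; lra.
have Ak : A * 4 < 2 ^+ k by near: k; exact: pow2_big.
(* Makes [a * K * 2^(k(1 - al))] at most a quarter of [2^k], so that at least [2^k / 4 > A] is
   left. *)
have big : 4 * (a * K) <= (2 ^+ k) `^ al.
  have kb : (4 * (a * K)) `^ al^-1 <= 2 ^+ k.
    by apply: ltW; near: k; exact: pow2_big.
  have aK0 : 0 <= 4 * (a * K) by rewrite mulr_ge0 ?ler0n// mulr_ge0// ltW.
  have := ge0_ler_powR (ltW al0) _ _ kb.
  by rewrite !nnegrE powR_ge0 (ltW p0) -powRrM mulVf ?gt_eqF// powRr1//; apply.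
have aD : a * D (2 ^+ k / 2) <= 2 ^+ k / 4.
  apply: (@le_trans _ _ (a * (K * (2 ^+ k) `^ (1 - al)))).
    by rewrite ler_wpM2l ?(ltW a0)// (le_trans (ler_norm _))// Db.
  rewrite ler_pdivlMr//.
  have -> : a * (K * (2 ^+ k) `^ (1 - al)) * 4 = 4 * (a * K) * (2 ^+ k) `^ (1 - al) by ring.
  apply: (@le_trans _ _ ((2 ^+ k) `^ al * (2 ^+ k) `^ (1 - al))).
    by apply: ler_wpM2r; [exact: powR_ge0 | exact: big].
  rewrite -powRD; last by rewrite (gt_eqF p0) implybT.
  by rewrite addrC subrK powRr1// ltW.
lra.
Unshelve. all: by end_near. Qed.

End RiemannLiouville.
(** * Hoelder regularity and growth of Brownian paths *)

Section DyadicHolder.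
Context {R : realType}.
Variables (lam : R).
Hypothesis lam0 : 0 < lam.

Local Notation q := ((2 : R) `^ (- lam)).

Let q0 : 0 < q. Proof. exact: powR_gt0. Qed.

Let q1 : q < 1.
Proof.
rewrite powRN invf_lt1 ?powR_gt0//.
have := gt0_ltr_powR lam0 _ _ (ltr1n R 2).
by rewrite powR1; apply; rewrite nnegrE.
Qed.

Let fl (m : nat) (s : R) : nat := Num.truncn (2 ^+ m * s).
Let dy (m : nat) (s : R) : R := (fl m s)%:R / 2 ^+ m.

Let p2 (m : nat) : 0 < 2 ^+ m :> R. Proof. exact: exprn_gt0. Qed.

Let flP m s : 0 <= s -> (fl m s)%:R <= 2 ^+ m * s < (fl m s).+1%:R.
Proof. by move=> s0; rewrite truncn_itv// mulr_ge0// ltW. Qed.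

Let dyP m s : 0 <= s -> dy m s <= s < dy m s + 2 ^- m.
Proof.
move=> s0; have /andP[h1 h2] := flP m _ s0.
rewrite /dy ler_pdivrMr// mulrC h1/= -{2}[2 ^- m]mul1r -mulrDl ltr_pdivlMr//.
by rewrite mulrC natr1.
Qed.

(** Hence the approximations of [s] at levels [m] and [m.+1] coincide or are neighbours at level
    [m.+1]. *)
Let fl_double m (s : R) : 0 <= s -> ((fl m s).*2 <= fl m.+1 s <= (fl m s).*2.+1)%N.
Proof.
move=> s0; have /andP[h1 h2] := flP m _ s0; have /andP[h3 h4] := flP m.+1 _ s0.
rewrite exprS -mulrA in h3 h4.
rewrite -natr1 in h2; rewrite -natr1 in h4.
apply/andP; split; rewrite -ltnS -(@ltr_nat R).
  by rewrite -mul2n natrM -natr1; lra.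
rewrite -addn2 -mul2n natrD natrM; lra.
Qed.

Section Path.
Variables (v : R -> R) (K : R).
Hypotheses (v_cont : continuous v) (K0 : 0 <= K).
Hypothesis v_dyadic : forall m j : nat, (j < 2 ^ m)%N ->
  `|v (j.+1%:R / 2 ^+ m) - v (j%:R / 2 ^+ m)| <= K * q ^+ m.

Local Notation A := ((1 - q)^-1).

Let A0 : 0 < A. Proof. by rewrite invr_gt0 subr_gt0. Qed.

Let fl_le m s : 0 <= s <= 1 -> (fl m s <= 2 ^ m)%N.
Proof.
move=> /andP[s0 s1]; have /andP[h1 _] := flP m _ s0.
by rewrite -(@ler_nat R) natrX (le_trans h1)// ger_pMr.
Qed.

Let v_step m s : 0 <= s <= 1 -> `|v (dy m.+1 s) - v (dy m s)| <= K * q ^+ m.+1.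
Proof.
move=> s01; have /andP[s0 _] := s01; have /andP[f1 f2] := fl_double m _ s0.
have dE : dy m s = (fl m s).*2%:R / 2 ^+ m.+1.
  rewrite /dy -mul2n natrM exprS; field.
  by rewrite expf_neq0.
rewrite dE /dy; move: f2; rewrite leq_eqVlt ltnS => /orP[/eqP fE|f2].
  rewrite fE; apply: v_dyadic.
  by have := fl_le m.+1 s s01; rewrite fE.
have -> : fl m.+1 s = (fl m s).*2 by apply/eqP; rewrite eqn_leq f1 f2.
by rewrite subrr normr0 mulr_ge0// exprn_ge0// ltW.
Qed.

(** The bound is the exact partial geometric sum of the steps, so the induction closes with an
    identity. *)
Let v_telescope m n s : 0 <= s <= 1 ->
  `|v (dy (m + n) s) - v (dy m s)| <= K * (A * q ^+ m.+1 * (1 - q ^+ n)).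
Proof.
move=> s01; elim: n => [|n IH].
  by rewrite addn0 !subrr normr0 mulr0 mulr0.
rewrite addnS.
have -> : v (dy (m + n).+1 s) - v (dy m s) =
  (v (dy (m + n).+1 s) - v (dy (m + n) s)) + (v (dy (m + n) s) - v (dy m s)) by ring.
apply: (le_trans (ler_normD _ _)); apply: (le_trans (lerD (v_step _ _ s01) IH)).
have -> : K * q ^+ (m + n).+1 = K * (A * q ^+ m.+1 * ((1 - q) * q ^+ n)).
  rewrite -addSn exprD; field.
  by rewrite subr_eq0 gt_eqF.
rewrite [q ^+ n.+1]exprS le_eqVlt; apply/orP; left; apply/eqP; ring.
Qed.

Let v_approx m s : 0 <= s <= 1 -> `|v s - v (dy m s)| <= K * A * q ^+ m.
Proof.
move=> s01; have /andP[s0 _] := s01; apply/ler_addgt0Pr => e e0.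
have /cvgrPdist_lt/(_ _ e0)/nbhs_ballP[d /= d0 dP] := v_cont s.
have [n nd] : exists n : nat, 2 ^- (m + n) < d.
  have [n _ /(_ n (leqnn n)) /= h] := near_expr_lt _ _ half01 d0.
  exists n; apply: le_lt_trans h.
  by rewrite exprVn lef_pV2 ?posrE// ler_eXn2l ?ltr1n// leq_addl.
have /andP[y1 y2] := dyP (m + n) _ s0.
have h1 : `|v s - v (dy (m + n) s)| < e.
  by apply: dP; rewrite /ball/= ger0_norm ?subr_ge0//; lra.
have h2 := v_telescope m n _ s01.
have -> : v s - v (dy m s) = (v s - v (dy (m + n) s)) + (v (dy (m + n) s) - v (dy m s)) by ring.
apply: (le_trans (ler_normD _ _)); rewrite addrC lerD ?(ltW h1)//.
apply: (le_trans h2).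
have -> : K * (A * q ^+ m.+1 * (1 - q ^+ n)) = K * A * (q ^+ m.+1 * (1 - q ^+ n)) by ring.
apply: ler_wpM2l; first by rewrite mulr_ge0// ltW.
have qm : 0 <= q ^+ m by rewrite exprn_ge0// ltW.
have qn : 0 <= 1 - q ^+ n by rewrite subr_ge0 exprn_ile1 ?(ltW q0) ?(ltW q1).
have qn1 : 1 - q ^+ n <= 1 by rewrite gerBl exprn_ge0// ltW.
rewrite exprS (le_trans (_ : _ <= q * q ^+ m))//.
  by rewrite ler_piMr// mulr_ge0// ltW.
by rewrite ler_piMl// ltW.
Qed.

(** At the level [m] with [2^-(m+1) < t - s <= 2^-m] the approximations of [s] and [t] coincide or
    are neighbours. Two approximation errors and one increment give [2 * A + 1];
    [2^-m < 2 * (t - s)] gives the factor 2^lam. *)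
Lemma dyadic_holder (s t : R) : 0 <= s <= 1 -> 0 <= t <= 1 ->
  `|v s - v t| <= K * ((2 * A + 1) * 2 `^ lam) * `|s - t| `^ lam.
Proof.
wlog st : s t / s < t => [hw s01 t01|s01 t01].
  have [st|ts|->] := ltgtP s t; first exact: hw.
    by rewrite distrC (distrC s t); exact: hw.
  by rewrite subrr normr0 mulr_ge0 ?powR_ge0// !mulr_ge0 ?powR_ge0// addr_ge0// mulr_ge0// ltW.
have d0 : 0 < t - s by rewrite subr_gt0.
have exm : exists m : nat, 2 ^- m.+1 < t - s.
  have [n _ /(_ n.+1 (leqnSn n)) /= h] := near_expr_lt _ _ half01 d0.
  by exists n; rewrite -exprVn.
case: (ex_minnP exm) => m md mmin.
have dm : t - s <= 2 ^- m.
  (* For [m = 0] minimality says nothing, but [t - s <= 1] in the unit interval. *)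
  case: m md mmin => [|m] md mmin.
    by rewrite expr0 invr1; case/andP: s01 => ? _; case/andP: t01 => _ ?; lra.
  rewrite leNgt; apply/negP => /mmin; by rewrite ltnn.
have [s0 s1] := andP s01; have [t0 t1] := andP t01.
have mid : `|v (dy m s) - v (dy m t)| <= K * q ^+ m.
  have /andP[f1 f2] := flP m _ s0; have /andP[g1 g2] := flP m _ t0.
  have le1 : (fl m s <= fl m t)%N.
    rewrite -ltnS -(@ltr_nat R) (le_lt_trans f1)// (le_lt_trans _ g2)//.
    by rewrite ler_pM2l// ltW.
  have le2 : (fl m t <= (fl m s).+1)%N.
    rewrite -ltnS -(@ltr_nat R) (le_lt_trans g1)// -natr1.
    have : 2 ^+ m * (t - s) <= 1 by rewrite mulrC -ler_pdivlMr// mul1r.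
    rewrite mulrBr; lra.
  move: le2; rewrite leq_eqVlt ltnS => /orP[/eqP fE|le2].
    rewrite distrC /dy fE; apply: v_dyadic.
    by rewrite -fE; exact: fl_le.
  have -> : dy m t = dy m s by rewrite /dy; congr (_%:R / _); apply/eqP; rewrite eqn_leq le1 le2.
  by rewrite subrr normr0 mulr_ge0// exprn_ge0// ltW.
have qm : q ^+ m <= 2 `^ lam * (t - s) `^ lam.
  have -> : q ^+ m = (2 ^- m) `^ lam.
    by rewrite -powR_mulrn ?powR_ge0// -powRrM -exprVn -powR_mulrn// -powR_inv1// -!powRrM; congr (_ `^ _); ring.
  rewrite -powRM ?(ltW d0)//.
  have n1 : (2 ^- m : R) \is Num.nneg by rewrite nnegrE invr_ge0 ltW.
  have n2 : 2 * (t - s) \is Num.nneg by rewrite nnegrE mulr_ge0// ltW.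
  apply: (ge0_ler_powR (ltW lam0) n1 n2).
  have -> : 2 ^- m = 2 * 2 ^- m.+1 :> R.
    by rewrite exprS invfM mulrA divff ?mul1r.
  by rewrite ler_pM2l// ltW.
rewrite (distrC s t) (gtr0_norm d0).
have -> : v s - v t = (v s - v (dy m s)) + (v (dy m s) - v (dy m t)) - (v t - v (dy m t)) by ring.
apply: (le_trans (ler_normB _ _)).
apply: (@le_trans _ _ (K * A * q ^+ m + K * q ^+ m + K * A * q ^+ m)).
  by apply: lerD; [apply: (le_trans (ler_normD _ _)); apply: lerD => // |]; exact: v_approx.
have -> : K * A * q ^+ m + K * q ^+ m + K * A * q ^+ m = K * (2 * A + 1) * q ^+ m by ring.
have -> : K * ((2 * A + 1) * 2 `^ lam) * (t - s) `^ lam =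
  K * (2 * A + 1) * (2 `^ lam * (t - s) `^ lam) by ring.
by rewrite ler_wpM2l// mulr_ge0// addr_ge0// mulr_ge0// ltW.
Qed.

End Path.

End DyadicHolder.

(** * Gaussian tails *)

Section GaussianTail.
Context {R : realType}.
Notation mu := (@lebesgue_measure R).

(** Half of the exponent [x^2 / (2 sigma^2)] is bounded through [c < |x|]; the other half is a
    Gaussian of standard deviation [sqrt 2 * sigma], whose normalisation costs [sqrt 2]. *)
Lemma normal_pdf_split (sigma c x : R) : 0 < sigma -> 0 <= c -> c < `|x| ->
  normal_pdf 0 sigma x <= Num.sqrt 2 * expR (- (c ^+ 2 / (sigma ^+ 2 *+ 4))) *
    normal_pdf 0 (Num.sqrt 2 * sigma) x.
Proof.
move=> s0 c0 cx; have s20 : 0 < Num.sqrt 2 * sigma :> R.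
  by rewrite mulr_gt0// sqrtr_gt0.
rewrite !normal_pdfE ?gt_eqF// /normal_peak /normal_fun.
have -> : (Num.sqrt 2 * sigma) ^+ 2 = 2 * sigma ^+ 2 :> R by rewrite exprMn sqr_sqrtr.
have -> : Num.sqrt (2 * sigma ^+ 2 * pi *+ 2) = Num.sqrt 2 * Num.sqrt (sigma ^+ 2 * pi *+ 2) :> R.
  by rewrite -sqrtrM//; congr Num.sqrt; ring.
set S := Num.sqrt (sigma ^+ 2 * pi *+ 2).
have S0 : 0 < S by rewrite sqrtr_gt0 mulrn_wgt0// mulr_gt0 ?pi_gt0// exprn_gt0.
have r20 : 0 < Num.sqrt 2 :> R by rewrite sqrtr_gt0.
set e1 := expR (- (c ^+ 2 / _)); set e2 := expR (- (x - 0) ^+ 2 / (2 * sigma ^+ 2 *+ 2)).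
have -> : Num.sqrt 2 * e1 * ((Num.sqrt 2 * S)^-1 * e2) = S^-1 * (e1 * e2).
  by field; rewrite !gt_eqF.
rewrite ler_pM2l ?invr_gt0// /e1 /e2 -expRD ler_expR subr0.
have c2 : c ^+ 2 <= x ^+ 2.
  by rewrite -(real_normK (num_real x)) ler_sqr ?nnegrE// ltW.
have -> : - x ^+ 2 / (sigma ^+ 2 *+ 2) =
    - (x ^+ 2 / (sigma ^+ 2 *+ 4)) + - x ^+ 2 / (2 * sigma ^+ 2 *+ 2).
  by field; rewrite gt_eqF.
rewrite lerD2r lerN2 ler_pM2r// invr_gt0 mulrn_wgt0// exprn_gt0//.
Qed.

Lemma measurable_norm_gt (c : R) : measurable [set x : R | c < `|x|].
Proof.
have mb : measurable_fun [set: R] (fun x : R => c < `|x|).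
  apply: measurable_fun_ltr; first exact: measurable_cst.
  exact: normr_measurable.
have := mb measurableT [set true] I; rewrite setTI.
by congr measurable; apply/seteqP; split => x /=.
Qed.

Lemma normal_tail (sigma c : R) : 0 < sigma -> 0 <= c ->
  (normal_prob 0 sigma [set x | (c < `|x|)%R] <=
   (Num.sqrt 2 * expR (- (c ^+ 2 / (sigma ^+ 2 *+ 4))))%:E)%E.
Proof.
move=> s0 c0; have s20 : 0 < Num.sqrt 2 * sigma :> R.
  by rewrite mulr_gt0// sqrtr_gt0.
set K := Num.sqrt 2 * _.
have K0 : 0 <= K by rewrite mulr_ge0// expR_ge0.
pose g x := normal_pdf 0 (Num.sqrt 2 * sigma) x.
pose A : set (measurableTypeR R) := [set x : R | c < `|x|].
have mA : measurable A by exact: measurable_norm_gt.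
have mg : measurable_fun [set: R] (fun x => K * g x).
  by apply: measurable_funM => //; exact: measurable_normal_pdf.
have le1 : (\int[mu]_(x in A) (normal_pdf 0 sigma x)%:E <= \int[mu]_(x in A) (K * g x)%:E)%E.
  apply: ge0_le_integral => //=.
  - by move=> x _; rewrite lee_fin normal_pdf_ge0.
  - by apply/measurable_EFinP; apply: measurable_funTS; exact: measurable_normal_pdf.
  - by apply/measurable_EFinP; exact: measurable_funTS.
  - by move=> x cx; rewrite lee_fin; exact: normal_pdf_split.
have le2 : (\int[mu]_(x in A) (K * g x)%:E <= \int[mu]_x (K * g x)%:E)%E.
  apply: ge0_subset_integral => //=.
  - exact/measurable_EFinP.
  - by move=> x _; rewrite lee_fin mulr_ge0// normal_pdf_ge0.
apply: (le_trans le1); apply: (le_trans le2).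
under eq_integral do rewrite EFinM.
rewrite ge0_integralZl_EFin//=.
- by rewrite integral_normal_pdf ?mule1// gt_eqF.
- by move=> x _; rewrite lee_fin normal_pdf_ge0.
- by apply/measurable_EFinP; exact: measurable_normal_pdf.
Qed.

Lemma expRN_le_pow (u : R) (n : nat) : 0 < u ->
  expR (- u) <= n.+1`!%:R * u ^- n.+1.
Proof.
move=> u0; rewrite expRN -[leRHS]invrK lef_pV2 ?posrE ?expR_gt0//; last first.
  by rewrite invr_gt0 mulr_gt0 ?ltr0n ?fact_gt0// invr_gt0 exprn_gt0.
rewrite invfM invrK mulrC; apply: le_trans (expR_ge1Dxn n (ltW u0)).
by rewrite lerDr.
Qed.

(** The order is free, so it can be raised until the bound outweighs the [2^m] intervals of a dyadic
    level. *)
Lemma normal_tail_pow (sigma c : R) (n : nat) : 0 < sigma -> 0 < c ->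
  (normal_prob 0 sigma [set x | (c < `|x|)%R] <=
   (Num.sqrt 2 * n.+1`!%:R * 4 ^+ n.+1 * (sigma ^+ 2 / c ^+ 2) ^+ n.+1)%:E)%E.
Proof.
move=> s0 c0; apply: (le_trans (normal_tail _ _ s0 (ltW c0))).
have u0 : 0 < c ^+ 2 / (sigma ^+ 2 *+ 4).
  by rewrite divr_gt0 ?exprn_gt0// mulrn_wgt0// exprn_gt0.
rewrite lee_fin -(mulrA (Num.sqrt 2)) -(mulrA (Num.sqrt 2)) ler_wpM2l//.
apply: (le_trans (expRN_le_pow _ n u0)); rewrite -mulrA.
rewrite ler_wpM2l// -exprVn -exprMn le_eqVlt; apply/orP; left; apply/eqP.
by congr (_ ^+ _); field; rewrite !gt_eqF.
Qed.

End GaussianTail.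
Lemma within_halfline_continuous {R : realType} (g : R -> R) :
  {within `[0, +oo[, continuous g} -> continuous (fun x : R => g (Num.max x 0)).
Proof.
move=> /continuous_within_itvcyP[gc g0] x.
have [x0|x0|->] := ltgtP x 0.
- apply/cvgrPdist_lt => e e0; near=> y.
  have y0 : y < 0 by near: y; exact: lt_nbhsl.
  by rewrite !max_r ?ltW// subrr normr0.
- rewrite /continuous_at max_l ?(ltW x0)//.
  apply: (@cvg_trans _ (g @ x)); last by apply: gc; rewrite in_itv/= x0.
  apply: near_eq_cvg; near=> y; rewrite max_l// ltW//; near: y; exact: lt_nbhsr.
- apply/cvgrPdist_lt => e e0; rewrite maxxx.
  move/cvgrPdist_lt/(_ _ e0) : g0; rewrite near_withinE => /nbhs_ballP[k /= k0 kP].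
  apply/nbhs_ballP; exists k => // y yk.
  have [y0|y0] := leP y 0; first by rewrite subrr normr0.
  exact: kP.
Unshelve. all: by end_near. Qed.

(** * Borel-Cantelli for Brownian increments over dyadic scales *)

Section BrownianPaths.
Context {d : measure_display} {T : measurableType d} {R : realType}.
Variables (P : probability T R) (W : R -> {RV P >-> R}) (lam : R).
Hypotheses (W_BM : standard_BM W) (lam_half : 0 < lam < 1 / 2).

Local Notation q := ((2 : R) `^ (- lam)).

(** The increment has standard deviation [2^((k - m) / 2)]. The factor [2 ^+ k] in the threshold,
    instead of the natural [2^(k / 2)], buys summability in [k]; [q ^+ m] is [(2^-m)^lam]. *)
Let bad (k m j : nat) : set T :=
  (fun w => W (2 ^+ k * (j.+1%:R / 2 ^+ m)) w - W (2 ^+ k * (j%:R / 2 ^+ m)) w) @^-1`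
    [set x : R | 2 ^+ k * q ^+ m < `|x|].

Let bad_measurable k m j : measurable (bad k m j).
Proof.
rewrite /bad -[X in measurable X]setTI.
have mW : measurable_fun setT (fun w => W (2 ^+ k * (j.+1%:R / 2 ^+ m)) w -
    W (2 ^+ k * (j%:R / 2 ^+ m)) w) by exact: measurable_funB.
exact: mW measurableT _ (measurable_norm_gt _).
Qed.

(** Variance over squared threshold is [2^-k * bet^m], and [bet < 1] means [lam < 1/2]. *)
Let bet : R := (2 * q ^+ 2)^-1.

Let bet_lt1 : 0 < bet < 1.
Proof.
have /andP[l0 l2] := lam_half.
have q20 : 0 < 2 * q ^+ 2 by rewrite mulr_gt0// exprn_gt0// powR_gt0.
rewrite /bet invr_gt0 q20 invf_lt1//.
have -> : 2 * q ^+ 2 = 2 `^ (1 - 2 * lam).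
  rewrite -powR_mulrn ?powR_ge0// -powRrM powRD ?powRr1//; last by rewrite pnatr_eq0 implybT.
  by congr (_ * _ `^ _); ring.
have e0 : 0 < 1 - 2 * lam by lra.
have := gt0_ltr_powR e0 _ _ (ltr1n R 2).
by rewrite powR1; apply; rewrite nnegrE.
Qed.

Let bad_le : exists2 K : R, 0 <= K & forall k m j : nat,
  (P (bad k m j) <= (K * 2 ^- k * 4 ^- m)%:E)%E.
Proof.
have /andP[b0 b1] := bet_lt1.
(* A factor [4^-1] per level beats the doubling of the number of intervals. *)
have [n bn] : exists n : nat, bet ^+ n.+1 <= 4^-1.
  have q0 : 0 < 4^-1 :> R by rewrite invr_gt0.
  have [n _ /(_ n.+1 (leqnSn n)) /ltW] := near_expr_lt _ _ bet_lt1 q0.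
  by exists n.
exists (Num.sqrt 2 * n.+1`!%:R * 4 ^+ n.+1) => [|k m j].
  by rewrite !mulr_ge0// exprn_ge0.
set K := Num.sqrt 2 * _ * _.
have K0 : 0 <= K by rewrite /K !mulr_ge0// exprn_ge0.
have p0 i : 0 < 2 ^+ i :> R by rewrite exprn_gt0.
pose s : R := 2 ^+ k * (j%:R / 2 ^+ m); pose t : R := 2 ^+ k * (j.+1%:R / 2 ^+ m).
have s0 : 0 <= s by rewrite mulr_ge0 ?(ltW (p0 _))// divr_ge0// ltW.
have tsE : t - s = 2 ^+ k / 2 ^+ m.
  rewrite /t /s -natr1; field.
  by rewrite expf_neq0.
have ts0 : 0 < t - s by rewrite tsE divr_gt0.
have c0 : 0 < 2 ^+ k * q ^+ m by rewrite mulr_gt0// exprn_gt0// powR_gt0.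
have st : s < t by rewrite -subr_gt0.
have sig0 : 0 < Num.sqrt (t - s) by rewrite sqrtr_gt0.
have Pbad : P (bad k m j) =
    normal_prob 0 (Num.sqrt (t - s)) [set x : R | 2 ^+ k * q ^+ m < `|x|].
  exact: (BM_gaussian_increments W_BM s0 st (measurable_norm_gt _)).
rewrite Pbad.
apply: (le_trans (normal_tail_pow _ _ n sig0 c0)).
rewrite lee_fin -/K -mulrA ler_wpM2l// sqr_sqrtr ?(ltW ts0)// tsE.
have -> : 2 ^+ k / 2 ^+ m / (2 ^+ k * q ^+ m) ^+ 2 = 2 ^- k * bet ^+ m.
  have -> : bet ^+ m = (2 ^+ m * (q ^+ m) ^+ 2)^-1.
    by rewrite /bet exprVn exprMn -!exprM mulnC.
  field.
  by rewrite !expf_neq0 ?gt_eqF ?powR_gt0// exprn_gt0// powR_gt0.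
rewrite exprMn; apply: ler_pM.
- by rewrite exprn_ge0// invr_ge0 ltW.
- by rewrite exprn_ge0// exprn_ge0// ltW.
- by rewrite exprS ler_piMr ?invr_ge0 ?(ltW (p0 _))// exprn_ile1 ?invr_ge0 ?(ltW (p0 _))// invf_le1// exprn_ege1// ler1n.
- by rewrite -exprM mulnC exprM -exprVn lerXn2r// nnegrE ?invr_ge0// exprn_ge0// ltW.
Qed.

Let level (k m : nat) : set T := \big[setU/set0]_(j < 2 ^ m) bad k m j.

Let level_measurable k m : measurable (level k m).
Proof. by apply: bigsetU_measurable => j _; exact: bad_measurable. Qed.

Let scale (k : nat) : set T := \bigcup_m level k m.

Let scale_measurable k : measurable (scale k).
Proof. by apply: bigcupT_measurable => m; exact: level_measurable. Qed.

Let geometric_half (r : R) : (\sum_(m <oo) (r / (2 ^ m.+1)%:R)%:E = r%:E)%E.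
Proof.
have := @cvg_geometric_eseries_half _ r 0; rewrite expr0 divr1 => /cvg_lim h.
rewrite -[RHS]h//; congr (limn _); apply/funext => n; rewrite /eseries/=.
by apply: eq_bigr => i _; rewrite addn1.
Qed.

Let scale_le : exists2 K : R, 0 <= K & forall k,
  (P (scale k) <= (K / (2 ^ k.+1)%:R)%:E)%E.
Proof.
(* Level [m] has [2^m] events of probability at most [K * 2^-k * 4^-m]; over all [m] this sums to
   [2 * K * 2^-k = 4 * K / 2^(k+1)]. *)
have [K K0 hK] := bad_le; exists (4 * K) => [|k]; first exact: mulr_ge0.
have level_le m : (P (level k m) <= (2 * K * 2 ^- k / (2 ^ m.+1)%:R)%:E)%E.
  apply: (le_trans (Boole_inequality _ _)); first by move=> i _; exact: bad_measurable.
  apply: (@le_trans _ _ (\sum_(i < 2 ^ m) (K * 2 ^- k * 4 ^- m)%:E)%E).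
    by apply: lee_sum => i _; exact: hK.
  rewrite sumEFin sumr_const card_ord lee_fin -[X in X <= _]mulr_natr !natrX exprS.
  have -> : 4 ^+ m = 2 ^+ m * 2 ^+ m :> R by rewrite -exprMn; congr (_ ^+ _); ring.
  rewrite le_eqVlt; apply/orP; left; apply/eqP; field.
  by rewrite !expf_neq0.
apply: (le_trans (generalized_Boole_inequality P (level_measurable k) (scale_measurable k))).
apply: (@le_trans _ _ (\sum_(m <oo) (2 * K * 2 ^- k / (2 ^ m.+1)%:R)%:E)%E).
  by apply: lee_nneseries => // m _; exact: level_le.
rewrite geometric_half lee_fin natrX exprS le_eqVlt; apply/orP; left; apply/eqP.
by field; rewrite expf_neq0.
Qed.

Lemma BM_dyadic_increments : {ae P, forall w, \forall k \near \oo,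
  forall m j : nat, (j < 2 ^ m)%N ->
    `|W (2 ^+ k * (j.+1%:R / 2 ^+ m)) w - W (2 ^+ k * (j%:R / 2 ^+ m)) w|
      <= 2 ^+ k * q ^+ m}.
Proof.
have [K K0 hK] := scale_le.
exists (lim_sup_set scale); split.
- apply: bigcapT_measurable => n; apply: bigcup_measurable => j _.
  exact: scale_measurable.
- apply: lim_sup_set_cvg0 => //.
  apply: (@le_lt_trans _ _ (\sum_(k <oo) (K / (2 ^ k.+1)%:R)%:E)%E).
    by apply: lee_nneseries => // k _; exact: hK.
  by rewrite geometric_half ltry.
- move=> w /= hw n _; apply: contrapT => nw; apply: hw.
  exists n => // k /= nk m j jm; rewrite leNgt; apply/negP => bw.
  apply: nw; exists k => //; exists m => //.
  by rewrite /level -bigcup_mkord; exists j.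
Qed.

(** The rescaled path [x -> W (2^k x)] obeys the dyadic bound with [K = 2^k]; undoing the scaling
    multiplies by [2^(-k lam)]. The constant found depends on [lam] only: chance enters through the
    first admissible [k]. *)
Lemma BM_holder_growth :
  {ae P, forall w, exists2 C : R, 0 <= C & \forall k \near \oo, forall s t,
    0 <= s <= 2 ^+ k -> 0 <= t <= 2 ^+ k ->
    `|W s w - W t w| <= C * (2 ^+ k) `^ (1 - lam) * `|s - t| `^ lam}.
Proof.
have /andP[lam0 _] := lam_half.
have := BM_continuous_paths W_BM; have := BM_dyadic_increments.
apply: filterS2 => w hdy hc.
exists ((2 / (1 - q) + 1) * 2 `^ lam).
  have q1 : q < 1.
    rewrite powRN invf_lt1 ?powR_gt0//.
    have := gt0_ltr_powR lam0 _ _ (ltr1n R 2).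
    by rewrite powR1; apply; rewrite nnegrE.
  by rewrite mulr_ge0 ?powR_ge0// addr_ge0// divr_ge0// subr_ge0 ltW.
apply: filterS hdy => k hk s t /andP[s0 sk] /andP[t0 tk].
have p0 : 0 < 2 ^+ k :> R by rewrite exprn_gt0.
pose v x := W (Num.max (2 ^+ k * x) 0) w.
have v_cont : continuous v.
  move=> x; apply: (@continuous_comp R R R (fun x => 2 ^+ k * x)
    (fun x => W (Num.max x 0) w)).
    by apply: cvgM; [exact: cvg_cst | exact: cvg_id].
  exact: (within_halfline_continuous _ hc).
have vE x : 0 <= x -> v x = W (2 ^+ k * x) w.
  by move=> x0; rewrite /v max_l// mulr_ge0// ltW.
have v_dyadic (m j : nat) : (j < 2 ^ m)%N ->
    `|v (j.+1%:R / 2 ^+ m) - v (j%:R / 2 ^+ m)| <= 2 ^+ k * q ^+ m.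
  by move=> jm; rewrite !vE ?divr_ge0 ?exprn_ge0//; exact: hk.
have unit (x : R) : 0 <= x -> x <= 2 ^+ k -> 0 <= x / 2 ^+ k <= 1.
  move=> x0 xk; apply/andP; split; first by rewrite divr_ge0// ltW.
  by rewrite ler_pdivrMr// mul1r.
have := dyadic_holder lam lam0 v _ v_cont (ltW p0) v_dyadic _ _ (unit _ s0 sk) (unit _ t0 tk).
rewrite !vE ?divr_ge0 ?(ltW p0)// !(mulrC _ (_ / _)) !divfK ?gt_eqF// => /le_trans; apply.
rewrite -mulrBl normrM (ger0_norm (_ : 0 <= (2 ^+ k)^-1)) ?invr_ge0 ?(ltW p0)//.
rewrite powRM ?invr_ge0 ?(ltW p0)//.
have -> : (2 ^+ k) `^ (1 - lam) = 2 ^+ k * (2 ^+ k)^-1 `^ lam :> R.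
  rewrite powRB; last by rewrite (gt_eqF p0) implybT.
  rewrite powRr1 ?(ltW p0)//; congr (_ * _).
  by rewrite -(powR_inv1 (ltW p0)) -powRrM mulN1r powRN.
rewrite le_eqVlt; apply/orP; left; apply/eqP; ring.
Qed.

End BrownianPaths.

(** * From one sample path to the processes *)

Lemma dE_eq_halfline {R : realType} (e e' e2 : R -> set R) :
  (forall t, 0 <= t -> e t = e' t) -> dE e e2 = dE e' e2.
Proof.
move=> ee'; rewrite /dE; congr (limn _); apply/funext => N; apply: eq_bigr => n _.
rewrite /dE_upto.
have -> // : graph_upto_star n%:R e = graph_upto_star n%:R e'.
rewrite /graph_upto_star; congr (_ `|` _); apply/seteqP.
by split => -[t v] /= [/andP[t0 tn] etv]; split; rewrite /= ?t0//; move: etv; rewrite /= ee'.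
Qed.

Lemma pathwise_excursion_cvg {R : realType} (a b c : R) (wa g : R -> R)
    (X : nat -> R -> R) :
  0 < b -> 0 <= c ->
  continuous (fun x : R => wa (Num.max x 0)) -> wa 0 = 0 ->
  (forall A : R, exists2 y, 0 < y & A < y - a * wa y) ->
  continuous (fun x : R => g (Num.max x 0)) ->
  (forall n, (0 < n)%N -> excursion_ode a b c n wa (X n)) ->
  let S t := [set expR (g x) |
    x in `[left_limit (first_passage a b wa) t, first_passage a b wa t]] in
  interval_valued S /\
  dE (fun t => [set expR (g (X n t))]) S @[n --> \oo] --> (0 : \bar R)%E.
Proof.
move=> b0 c0 wa_cont wa0 wa_sub g_cont X_ode S.
(* Paths are frozen at their value at 0 on the negative half-line, to be continuous on the whole
   line. *)
pose f (y : R) := Num.max y 0 - a * wa (Num.max y 0).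
have fE y : 0 <= y -> f y = y - a * wa y by move=> y0; rewrite /f max_l.
have f_cont : continuous f.
  move=> y; apply: cvgB.
    by apply: continuous_max; [exact: cvg_id | exact: cvg_cst].
  by apply: cvgM; [exact: cvg_cst | exact: wa_cont].
have f0 : f 0 = 0 by rewrite fE// wa0 mulr0 subr0.
have f_unbounded A : exists2 y, 0 < y & A < f y.
  by have [y y0 Ay] := wa_sub A; exists y => //; rewrite fE ?(ltW y0).
have passageE : first_passage a b wa = passage f b.
  apply/funext => t; rewrite /first_passage /passage; congr inf.
  by apply/seteqP; split => x /= [x0 fx]; split => //; move: fx; rewrite fE// ltW.
pose E (y : R) := expR (g (Num.max y 0)).
have E_cont : continuous E.
  move=> y; apply: (@continuous_comp R R R (fun x => g (Num.max x 0)) (@expR R)).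
    exact: g_cont.
  exact: continuous_expR.
have SE : S = (fun t => [set E x | x in `[left_limit (passage f b) t, passage f b t]]).
  apply/funext => t; rewrite /S passageE.
  have l0 : 0 <= left_limit (passage f b) t by exact: left_limit_passage_ge0.
  apply/seteqP; split => _ [x xlu <-]; exists x => //; rewrite /E max_l//;
    by move: xlu; rewrite /= in_itv/= => /andP[lx _]; exact: le_trans lx.
have X0 n : (0 < n)%N -> X n 0 = 0 by move=> /X_ode[].
have X_ge0 n t : (0 < n)%N -> 0 <= t -> 0 <= X n t.
  by move=> /X_ode[_ h] /h[].
have X_d n t : (0 < n)%N -> 0 <= t ->
    has_derivative_Rplus (X n) t (n%:R * (b * t - f (X n t)) + c).
  move=> n0 t0; have [_ /(_ t t0)[x0]] := X_ode n n0.
  by rewrite fE//; congr (has_derivative_Rplus _ _ _); ring.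
rewrite SE; split.
  exact: excursion_interval_valued.
have := excursion_dE_cvg f b c E X b0 c0 f_cont f0 f_unbounded X0 X_ge0 X_d.
(* Index 0 carries no equation, so the graphs are compared for [n > 0] only. *)
apply: cvg_trans; apply: near_eq_cvg; near=> n.
apply: dE_eq_halfline => t t0; rewrite /E max_l//; apply: X_ge0 => //.
by near: n; exact: nbhs_infty_gt.
Unshelve. all: by end_near. Qed.

Theorem mainTheorem17 (d : measure_display) (T : measurableType d)
    (R : realType) (P : probability T R)
    (W0 W1 : R -> {RV P >-> R}) (hW : standard_BM2 W0 W1)
    (a b c alpha rho : R) (ha : 0 < a) (hb : 0 < b) (hc : 0 < c)
    (halpha : 0 < alpha < 1 / 2) (hrho : -1 <= rho <= 1)
    (X : nat -> R -> {RV P >-> R}) :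
  let Walpha (w : T) : R -> R := riemann_liouville alpha (fun t => W1 t w) in
  let Wrho (w : T) (x : R) : R :=
    Num.sqrt (1 - rho ^+ 2) * W0 x w + rho * W1 x w in
  forall hX : (forall n : nat, (0 < n)%N ->
    {ae P, forall w, excursion_ode a b c n (Walpha w) (fun t => X n t w)}),
  let Sn (n : nat) (t : R) (w : T) : R :=
    expR (Wrho w (X n t w) - 1 / 2 * X n t w) in
  let X0 (w : T) : R -> R := first_passage a b (Walpha w) in
  let Sbullet (w : T) (t : R) : set R :=
    [set expR (Wrho w x - 1 / 2 * x) |
      x in `[left_limit (X0 w) t, X0 w t]] in
  {ae P, forall w,
    interval_valued (Sbullet w) /\
    dE (fun t => [set Sn n t w]) (Sbullet w) @[n --> \oo] --> (0 : \bar R)%E}.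
Proof.
move=> Walpha Wrho hX Sn X0 Sbullet.
have [W0_BM W1_BM _] := hW; have /andP[al0 al2] := halpha.
(* Above [alpha] for the fractional derivative, below 1/2 for Brownian motion. *)
pose lam := (alpha + 1 / 2) / 2.
have al_lam : alpha < lam by rewrite /lam; lra.
have al1 : alpha < 1 by lra.
have lam_half : 0 < lam < 1 / 2 by rewrite /lam; lra.
have odes : {ae P, forall w, forall n, (0 < n)%N ->
    excursion_ode a b c n (Walpha w) (fun t => X n t w)}.
  (* Countably many null sets are merged; at index 0 the claim is vacuous. *)
  apply/ae_foralln => -[|n]; first by apply: aeW.
  by apply: filterS (hX n.+1 isT).
have paths : {ae P, forall w, [/\ W1 0 w = 0,
    {within `[0, +oo[, continuous (fun t => W0 t w)} &
    {within `[0, +oo[, continuous (fun t => W1 t w)}]}.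
  have := BM_continuous_paths W1_BM; have := BM_continuous_paths W0_BM.
  by have := BM_start W1_BM; apply: filterS3.
have := odes; have := paths; have := BM_holder_growth P W1 lam W1_BM lam_half.
apply: filterS3 => w [C C0 h1] [z1 c0 c1] {}odes.
have wa_cont := riemann_liouville_continuous _ _ al0 al_lam al1 _ _ C0 z1 h1.
have wa0 := riemann_liouville_at0 _ _ al0 al_lam al1 _ _ C0 z1 h1.
have wa_sub := riemann_liouville_sublinear _ _ al0 al_lam al1 _ _ _ C0 z1 ha h1.
apply: (pathwise_excursion_cvg a b c (Walpha w)
  (fun x => Wrho w x - 1 / 2 * x) (fun n t => X n t w) hb (ltW hc) wa_cont wa0 wa_sub _ odes).
move=> x; apply: cvgB; last first.
  apply: cvgM; first exact: cvg_cst.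
  by apply: continuous_max; [exact: cvg_id | exact: cvg_cst].
apply: cvgD; apply: cvgM; try exact: cvg_cst.
  exact: (within_halfline_continuous _ c0).
exact: (within_halfline_continuous _ c1).
Qed.
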